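(* For a real number $\alpha>0$ let $G_\alpha$ be the simply connected $3$-dimensional solvable Lie group $$G_\alpha=\left\{\begin{pmatrix} e^{\alpha x} & 0 & y \\ 0 & e^{-x} & z \\ 0 & 0 & 1 \end{pmatrix}\ \middle|\ x,y,z\in\mathbb{R}\right\}.$$ Then for every $\alpha>0$ and every left-invariant Riemannian metric on $G_\alpha$, the group $G_\alpha$ does not admit any local conformal foliation by geodesics, i.e. no non-empty connected open subset of $G_\alpha$ carries a conformal foliation by geodesics.
   Context: Let $\mathcal{V}$ be an involutive distribution on a Riemannian manifold $(M,g)$ (identified with the corresponding foliation), $\mathcal{H}$ its orthogonal complement, and use $\mathcal{V},\mathcal{H}$ also for the orthogonal projections onto these subbundles. Put $$B^{\mathcal{V}}(U,V)=\tfrac12\mathcal{H}(\nabla_UV+\nabla_VU)\ (U,V\in\mathcal{V}),\qquad B^{\mathcal{H}}(X,Y)=\tfrac12\mathcal{V}(\nabla_XY+\nabla_YX)\ (X,Y\in\mathcal{H}).$$ $\mathcal{V}$ is conformal if there is a vector field $V$ tangent to $\mathcal{V}$ with $B^{\mathcal{H}}=g\otimes V$. $\mathcal{V}$ is totally geodesic if $B^{\mathcal{V}}=0$. A conformal foliation by geodesics is a $1$-dimensional conformal and totally geodesic foliation. *)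

(* Defs.v *)
From HB Require Import structures.
From mathcomp Require Import all_boot all_order all_algebra.
From mathcomp Require Import all_classical all_reals all_analysis.
Set Implicit Arguments.
Unset Strict Implicit.
Unset Printing Implicit Defensive.
Import Order.TTheory GRing.Theory Num.Theory.
Import numFieldNormedType.Exports.
Local Open Scope classical_set_scope.
Local Open Scope ring_scope.

(* Riemannian geometry on open subsets of R^n, in the standard coordinates.
   Points and tangent vectors are row vectors; a vector field is a map
   'rV_n -> 'rV_n, a metric is the map p |-> (g_ij(p)), and a distribution is
   a map D : 'rV_n -> 'M_n whose fibre at p is the row space of D p.  All of
   these are total functions: only their values on the open set under
   consideration matter. *)

Section Calculus.
Context {R : realType} {n : nat}.

Definition pd (i : 'I_n) (f : 'rV[R]_n -> R) : 'rV[R]_n -> R :=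
  'D_(delta_mx 0 i) f.

Definition iter_pd (s : seq 'I_n) (f : 'rV[R]_n -> R) : 'rV[R]_n -> R :=
  foldr pd f s.

(* C^oo: every iterated partial derivative is differentiable, hence also
   continuous, on W *)
Definition smooth_fun (W : set 'rV[R]_n) (f : 'rV[R]_n -> R) : Prop :=
  forall (s : seq 'I_n) (p : 'rV[R]_n), W p -> differentiable (iter_pd s f) p.

Definition smooth_mx (m k : nat) (W : set 'rV[R]_n)
    (F : 'rV[R]_n -> 'M[R]_(m, k)) : Prop :=
  forall i j, smooth_fun W (fun p => F p i j).

Definition lie_bracket (X Y : 'rV[R]_n -> 'rV[R]_n) (p : 'rV[R]_n) : 'rV[R]_n :=
  \row_k ('D_(X p) (fun q => Y q 0 k) p - 'D_(Y p) (fun q => X q 0 k) p).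

End Calculus.

Section Riemannian.
Context {R : realType} {n : nat}.
Variable g : 'rV[R]_n -> 'M[R]_n.

Definition inner (p u v : 'rV[R]_n) : R := (u *m g p *m v^T) 0 0.

Definition riemannian_metric (W : set 'rV[R]_n) : Prop :=
  [/\ smooth_mx W g,
      forall p, W p -> (g p)^T = g p
    & forall p u, W p -> u != 0 -> 0 < inner p u u].

(* Gamma^k_ij
   = 1/2 sum_l g^kl (d_i g_jl + d_j g_il - d_l g_ij) *)
Definition christoffel (k i j : 'I_n) (p : 'rV[R]_n) : R :=
  2^-1 * \sum_l invmx (g p) k l *
    (pd i (fun q => g q j l) p + pd j (fun q => g q i l) p
     - pd l (fun q => g q i j) p).

(* Levi-Civita connection *)
Definition nabla (X Y : 'rV[R]_n -> 'rV[R]_n) (p : 'rV[R]_n) : 'rV[R]_n :=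
  \row_k ('D_(X p) (fun q => Y q 0 k) p
          + \sum_i \sum_j christoffel k i j p * X p 0 i * Y p 0 j).

End Riemannian.

Section Distributions.
Context {R : realType} {n : nat}.

(* smooth subbundle of rank k of the tangent bundle of W *)
Definition distribution (k : nat) (W : set 'rV[R]_n)
    (D : 'rV[R]_n -> 'M[R]_n) : Prop :=
  forall p, W p -> exists (U : set 'rV[R]_n) (F : 'rV[R]_n -> 'M[R]_(k, n)),
    [/\ open U, U p, U `<=` W, smooth_mx U F
      & forall q, U q -> row_free (F q) /\ (D q == F q)%MS].

Definition section_on (W : set 'rV[R]_n) (D : 'rV[R]_n -> 'M[R]_n)
    (X : 'rV[R]_n -> 'rV[R]_n) : Prop :=
  smooth_mx W X /\ forall p, W p -> (X p <= D p)%MS.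

Definition involutive_on (W : set 'rV[R]_n) (D : 'rV[R]_n -> 'M[R]_n) : Prop :=
  forall (U : set 'rV[R]_n) (X Y : 'rV[R]_n -> 'rV[R]_n),
    open U -> U `<=` W -> section_on U D X -> section_on U D Y ->
    forall p, U p -> (lie_bracket X Y p <= D p)%MS.

Variable g : 'rV[R]_n -> 'M[R]_n.

(* u lies in the row space of orth D p iff inner g p u v = 0 for all v in the
   row space of D p *)
Definition orth (D : 'rV[R]_n -> 'M[R]_n) (p : 'rV[R]_n) : 'M[R]_n :=
  kermx (g p *m (D p)^T).

Definition orth_proj (D : 'rV[R]_n -> 'M[R]_n) (p u : 'rV[R]_n) : 'rV[R]_n :=
  u *m proj_mx (D p) (orth D p).

(* B^D (X, Y) for sections X, Y of D, projected onto the orthogonal complement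
   of D.  For D = orth D' this projection is the one onto D', because
   orth (orth D') has the same fibres as D'.  As B^D is tensorial, it is
   determined by its values on local sections. *)
Definition second_form (D : 'rV[R]_n -> 'M[R]_n)
    (X Y : 'rV[R]_n -> 'rV[R]_n) (p : 'rV[R]_n) : 'rV[R]_n :=
  2^-1 *: orth_proj (orth D) p (nabla g X Y p + nabla g Y X p).

Definition totally_geodesic (W : set 'rV[R]_n) (D : 'rV[R]_n -> 'M[R]_n)
    : Prop :=
  forall (U : set 'rV[R]_n) (X Y : 'rV[R]_n -> 'rV[R]_n),
    open U -> U `<=` W -> section_on U D X -> section_on U D Y ->
    forall p, U p -> second_form D X Y p = 0.

Definition conformal (W : set 'rV[R]_n) (D : 'rV[R]_n -> 'M[R]_n) : Prop :=
  exists V : 'rV[R]_n -> 'rV[R]_n, section_on W D V /\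
    forall (U : set 'rV[R]_n) (X Y : 'rV[R]_n -> 'rV[R]_n),
      open U -> U `<=` W ->
      section_on U (orth D) X -> section_on U (orth D) Y ->
      forall p, U p ->
        second_form (orth D) X Y p = inner g p (X p) (Y p) *: V p.

Definition conformal_foliation_by_geodesics (W : set 'rV[R]_n)
    (D : 'rV[R]_n -> 'M[R]_n) : Prop :=
  [/\ distribution 1 W D, involutive_on W D, conformal W D
    & totally_geodesic W D].

End Distributions.

Section Group.
Context {R : realType}.
Variable alpha : R.

Definition Gmx (x y z : R) : 'M[R]_3 :=
  \matrix_(i, j) nth 0 (nth [::] [:: [:: expR (alpha * x); 0; y];
                                     [:: 0; expR (- x); z];
                                     [:: 0; 0; 1]] i) j.

Definition Galpha : set 'M[R]_3 := [set A | exists x y z, A = Gmx x y z].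

(* Gparam : R^3 -> G_alpha is a diffeomorphism with inverse Gchart; metrics on
   G_alpha and subsets of G_alpha are read in these global coordinates. *)
Definition Gparam (p : 'rV[R]_3) : 'M[R]_3 := Gmx (p 0 0) (p 0 1) (p 0 2).

Definition Gchart (A : 'M[R]_3) : 'rV[R]_3 :=
  \row_k nth 0 [:: - ln (A 1 1); A 0 2; A 1 2] k.

(* left translation by a, read in the coordinates *)
Definition left_trans (a : 'M[R]_3) (p : 'rV[R]_3) : 'rV[R]_3 :=
  Gchart (a *m Gparam p).

Definition left_invariant (g : 'rV[R]_3 -> 'M[R]_3) : Prop :=
  forall a, Galpha a -> forall p u v : 'rV[R]_3,
    inner g (left_trans a p) ('d (left_trans a) p u) ('d (left_trans a) p v)
    = inner g p u v.

Lemma Galpha_Gparam p : Galpha (Gparam p).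
Proof. by exists (p 0 0), (p 0 1), (p 0 2). Qed.

Lemma GparamK : cancel Gparam Gchart.
Proof.
move=> p; apply/rowP => k; rewrite !mxE /= expRK opprK.
by case: k => [[|[|[|//]]]] ?; congr (p _ _); apply/val_inj.
Qed.

Lemma GchartK A : Galpha A -> Gparam (Gchart A) = A.
Proof.
move=> [x [y [z ->]]].
by rewrite /Gparam !mxE /= expRK opprK.
Qed.

Lemma Galpha_mul A B : Galpha A -> Galpha B -> Galpha (A *m B).
Proof.
move=> [x [y [z ->]]] [x' [y' [z' ->]]].
exists (x + x'), (expR (alpha * x) * y' + y), (expR (- x) * z' + z).
apply/matrixP => i j; rewrite !mxE !big_ord_recl big_ord0 !mxE /=.
case: i => [[|[|[|//]]]] ?; case: j => [[|[|[|//]]]] ? /=;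
  by rewrite ?(mulr0, mul0r, mulr1, mul1r, addr0, add0r) // -expRD
             ?mulrDr ?opprD.
Qed.

Lemma Gparam_left_trans a p :
  Galpha a -> Gparam (left_trans a p) = a *m Gparam p.
Proof. by move=> Ga; apply/GchartK/Galpha_mul => //; exact: Galpha_Gparam. Qed.

End Group.

(* Main.v *)
(* Let T be a local unit section of the foliation.  Being geodesic and conformal amounts
   to L_T g = 2 rho (g - T^b (x) T^b) for a function rho.  There is a left-invariant
   orthonormal frame with
     [e1,e2] = p e2,  [e1,e3] = 2k e2 - c e3,  [e2,e3] = 0,  p, c > 0,
   in which, writing T = sum t_i e_i, all derivatives e_i t_j are polynomials in the t_i,
   rho and the twist w of T.  The commutation relations of the e_i, contracted with T and
   symmetrised (the trace-free part of the Riccati equation along T), then say that the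
   Ricci curvature restricted to the orthogonal complement of T is a multiple of g.
   Because p c > 0, the Ricci curvature is strictly smallest exactly on the e1-axis, which
   forces t1 <> 0 and makes t2 and t3 locally constant.  But e2 t2 = e3 t3 = 0 reads
   rho (1 - t2^2) = - p t1 and rho (1 - t3^2) = c t1, so p c t1^2 <= 0. *)
Require Import Defs.
From mathcomp Require Import all_boot all_order all_algebra.
From mathcomp Require Import all_classical all_reals all_analysis.
From mathcomp Require Import ring lra.
Import Order.TTheory GRing.Theory Num.Theory.
Import numFieldNormedType.Exports.
Local Open Scope classical_set_scope.
Local Open Scope ring_scope.
Set Implicit Arguments.
Unset Strict Implicit.
Unset Printing Implicit Defensive.

(** * Smooth functions *)

(** A symmetric form on a Euclidean 3-space that is not a multiple of the metric is a multiple of it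
    on at most two planes, the circular sections of its quadric. The Ricci form of a left-invariant
    metric has constant coefficients in the frame, so T is normal to one of finitely many fixed
    planes; hence its components are locally constant. The proof uses this finiteness in algebraic
    form: t1^2, t2^2, t3^2 and t2 t3 satisfy relations with constant coefficients, which are
    differentiated. They fail to determine the derivatives only where the two planes merge, at T =
    e1 up to sign, and that case is handled apart. Ricci enters because in dimension three
    <R(X,T)T,Y> = (scal/2) <X,Y> - Ric(T x X, T x Y) for X, Y orthogonal to the unit vector T. The
    curvature tensor itself is never formed: its components appear through commutators of
    derivatives, and the Levi-Civita connection serves only to turn the two second fundamental forms
    into L_T g. *)

Lemma near_eq_differentiable (R : numFieldType) (V W : normedModType R)
    (f h : V -> W) (p : V) : (\forall q \near p, f q = h q) ->
  differentiable f p -> differentiable h p.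
Proof.
move=> fh df; have [cdf fE] := (diff_locallyP _ _).1 df.
have hE : h \o shift p = cst (h p) + 'd f p +o_ 0 id.
  apply/eqaddoP => e e0.
  move/eqaddoP : fE => /(_ e e0).
  have : \forall q \near 0, f (q + p) = h (q + p).
    by have := fh; rewrite (near_shift 0) /= subr0.
  apply: filterS2 => q qE.
  by rewrite /= !fctE /= qE (nbhs_singleton fh).
have dE := diff_unique cdf hE.
by apply/diff_locallyP; rewrite dE.
Qed.

Section SmoothCalculus.
Context {R : realType} {n : nat}.
Implicit Types (W U : set 'rV[R]_n) (f h : 'rV[R]_n -> R) (i j : 'I_n).

Lemma iter_pd_rcons s i f : iter_pd (rcons s i) f = iter_pd s (pd i f).
Proof. by rewrite /iter_pd foldr_rcons. Qed.

(** Grading smoothness by order makes induction possible: the partial derivatives of a product are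
    sums of products whose factors are controlled to one order less. *)
Definition diff_upto (m : nat) W f := forall s : seq 'I_n,
  (size s <= m)%N -> forall p, W p -> differentiable (iter_pd s f) p.

Lemma smooth_diff_upto W f : smooth_fun W f <-> forall m, diff_upto m W f.
Proof.
split=> [sf m s _ p|sf s p]; first exact: sf.
exact: (sf (size s) s (leqnn _)).
Qed.

Lemma diff_upto0 W f : diff_upto 0 W f <-> forall p, W p -> differentiable f p.
Proof.
split=> [df p Wp|df s]; first exact: (df [::]).
by rewrite leqn0 size_eq0 => /eqP ->; apply: df.
Qed.

Lemma diff_uptoS m W f : diff_upto m.+1 W f <->
  (forall p, W p -> differentiable f p) /\ forall i, diff_upto m W (pd i f).
Proof.
split=> [df|[df dpf] s].
  split=> [p Wp|i s sm p Wp]; first exact: (df [::]).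
  by rewrite -iter_pd_rcons; apply: df => //; rewrite size_rcons.
elim/last_ind: s => [_ p Wp|s i _]; first exact: df.
by rewrite size_rcons iter_pd_rcons ltnS; apply: dpf.
Qed.

Lemma diff_uptoW m W f : diff_upto m.+1 W f -> diff_upto m W f.
Proof. by move=> df s sm; apply: df; rewrite ltnW. Qed.

Lemma eq_on_near W f h p : open W -> W p -> (forall q, W q -> f q = h q) ->
  \forall q \near p, f q = h q.
Proof.
move=> oW Wp fh; have : nbhs p W by apply: open_nbhs_nbhs.
by apply: filterS.
Qed.

Lemma eq_on_differentiable W f h p : open W -> W p ->
  (forall q, W q -> f q = h q) -> differentiable f p -> differentiable h p.
Proof. by move=> oW Wp fh; apply: near_eq_differentiable; apply: eq_on_near fh. Qed.

Lemma eq_on_derive W f h p v : open W -> W p ->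
  (forall q, W q -> f q = h q) -> 'D_v f p = 'D_v h p.
Proof. by move=> oW Wp fh; apply: near_eq_derive; apply: eq_on_near fh. Qed.

Lemma eq_on_diff_upto m W f h : open W -> (forall q, W q -> f q = h q) ->
  diff_upto m W f -> diff_upto m W h.
Proof.
move=> oW; elim: m f h => [|m IH] f h fh.
  rewrite !diff_upto0 => df p Wp.
  exact: (eq_on_differentiable oW Wp fh (df p Wp)).
rewrite !diff_uptoS => -[df dpf]; split=> [p Wp|i].
  exact: (eq_on_differentiable oW Wp fh (df p Wp)).
by apply: IH (dpf i) => q Wq; apply: eq_on_derive fh.
Qed.

Lemma eq_on_smooth W f h : open W -> (forall q, W q -> f q = h q) ->
  smooth_fun W f -> smooth_fun W h.
Proof.
by move=> oW fh; rewrite !smooth_diff_upto => sf m; apply: eq_on_diff_upto fh _.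
Qed.

Lemma smooth_sub U W f : U `<=` W -> smooth_fun W f -> smooth_fun U f.
Proof. by move=> UW sf s p /UW; apply: sf. Qed.

Lemma smooth_differentiable W f p : smooth_fun W f -> W p -> differentiable f p.
Proof. by move=> sf; apply: (sf [::]). Qed.

Lemma smooth_pd W f i : smooth_fun W f -> smooth_fun W (pd i f).
Proof. by move=> sf s p Wp; rewrite -iter_pd_rcons; apply: sf. Qed.

Lemma diff_upto_cst m W (a : R) : diff_upto m W (fun=> a).
Proof.
elim: m a => [|m IH] a; first by rewrite diff_upto0 => p _; apply: differentiable_cst.
rewrite diff_uptoS; split=> [p _|i]; first exact: differentiable_cst.
suff -> : pd i (fun=> a) = (fun=> 0) by exact: IH.
by apply/funext => p; rewrite /pd; apply: derive_cst.
Qed.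

Lemma diff_uptoD m W f h : open W -> diff_upto m W f -> diff_upto m W h ->
  diff_upto m W (fun p => f p + h p).
Proof.
move=> oW; elim: m f h => [|m IH] f h.
  by rewrite !diff_upto0 => df dh p Wp; apply: differentiableD; auto.
rewrite !diff_uptoS => -[df dpf] [dh dph]; split=> [p Wp|i].
  by apply: differentiableD; auto.
apply: (@eq_on_diff_upto _ _ (fun p => pd i f p + pd i h p)) => //; last exact: IH.
move=> q Wq; rewrite /pd -deriveD //; apply: diff_derivable; auto.
Qed.

Lemma diff_uptoM m W f h : open W -> diff_upto m W f -> diff_upto m W h ->
  diff_upto m W (fun p => f p * h p).
Proof.
move=> oW; elim: m f h => [|m IH] f h.
  by rewrite !diff_upto0 => df dh p Wp; apply: differentiableM; auto.
move=> df dh; have [cf cpf] := (diff_uptoS _ _ _).1 df.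
have [ch cph] := (diff_uptoS _ _ _).1 dh.
apply/diff_uptoS; split=> [p Wp|i]; first by apply: differentiableM; auto.
apply: (@eq_on_diff_upto _ _ (fun p => f p * pd i h p + h p * pd i f p)) => //.
  move=> q Wq; rewrite /pd.
  have -> : (fun p => f p * h p) = f * h by [].
  by rewrite deriveM //; apply: diff_derivable; auto.
by apply: diff_uptoD => //; apply: IH => //; apply: diff_uptoW.
Qed.

Lemma smooth_cst W (a : R) : smooth_fun W (fun=> a).
Proof. by rewrite smooth_diff_upto => m; apply: diff_upto_cst. Qed.

Lemma smoothD W f h : open W -> smooth_fun W f -> smooth_fun W h ->
  smooth_fun W (fun p => f p + h p).
Proof.
move=> oW; rewrite !smooth_diff_upto => sf sh m.
by apply: diff_uptoD.
Qed.

Lemma smoothM W f h : open W -> smooth_fun W f -> smooth_fun W h ->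
  smooth_fun W (fun p => f p * h p).
Proof.
move=> oW; rewrite !smooth_diff_upto => sf sh m.
by apply: diff_uptoM.
Qed.

Lemma smoothN W f : open W -> smooth_fun W f -> smooth_fun W (fun p => - f p).
Proof.
move=> oW sf; have -> : (fun p => - f p) = (fun p => -1 * f p).
  by apply/funext => p; rewrite mulN1r.
by apply: smoothM => //; apply: smooth_cst.
Qed.

Lemma smoothB W f h : open W -> smooth_fun W f -> smooth_fun W h ->
  smooth_fun W (fun p => f p - h p).
Proof. by move=> oW sf sh; apply: smoothD => //; apply: smoothN. Qed.

Lemma smooth_sum W (I : Type) (r : seq I) (P : pred I) (F : I -> 'rV[R]_n -> R) :
  open W -> (forall k : I, smooth_fun W (F k)) ->
  smooth_fun W (fun p => \sum_(k <- r | P k) F k p).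
Proof.
move=> oW sF; elim: r => [|k r IH].
  have -> : (fun p => \sum_(k <- [::] | P k) F k p) = (fun=> 0).
    by apply/funext => p; rewrite big_nil.
  exact: smooth_cst.
have -> : (fun p => \sum_(j <- k :: r | P j) F j p) =
    (fun p => (if P k then F k p else 0) + \sum_(j <- r | P j) F j p).
  by apply/funext => p; rewrite big_cons; case: (P k); rewrite ?add0r.
by apply: smoothD => //; case: (P k) => //; apply: smooth_cst.
Qed.

Lemma derive_coord (p v : 'rV[R]_n) i : 'D_v (fun q : 'rV[R]_n => q 0 i) p = v 0 i.
Proof.
have dp : derivable (@id 'rV[R]_n) p v by [].
have := derive_mx dp; rewrite derive_id.
by move/matrixP/(_ 0 i) ->; rewrite mxE.
Qed.

Lemma smooth_coord W i : smooth_fun W (fun p => p 0 i).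
Proof.
rewrite smooth_diff_upto => -[|m].
  by rewrite diff_upto0 => p _; apply: differentiable_coord.
rewrite diff_uptoS; split=> [p _|j]; first exact: differentiable_coord.
suff -> : pd j (fun p : 'rV[R]_n => p 0 i) = (fun=> (delta_mx 0 j : 'rV[R]_n) 0 i).
  exact: diff_upto_cst.
by apply/funext => p; rewrite /pd derive_coord.
Qed.

Lemma derive_comp_scalar (phi : R -> R) (dphi : R) f p v :
  differentiable f p -> is_derive (f p) 1 phi dphi ->
  differentiable (phi \o f) p /\ 'D_v (phi \o f) p = dphi * 'D_v f p.
Proof.
move=> df [/derivable1_diffP dphi1 dphiE].
have dc : differentiable (phi \o f) p by apply: differentiable_comp.
split=> //; rewrite !deriveE // diff_comp // /= diff1E // derive1E dphiE.
by rewrite mulrC.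
Qed.

(** An autonomous equation phi' = c phi^k expresses every derivative of [phi \o f] through
    [phi \o f] itself and derivatives of [f], so smoothness bootstraps order by order. The
    exponential is the case c = k = 1, and x^(-1/2) the case c = -1/2, k = 3. *)
Lemma smooth_comp_ode W (phi : R -> R) (c : R) (k : nat) f : open W ->
  (forall p, W p -> is_derive (f p) 1 phi (c * phi (f p) ^+ k)) ->
  smooth_fun W f -> smooth_fun W (fun p => phi (f p)).
Proof.
move=> oW dphi sf; rewrite smooth_diff_upto => m.
have df p : W p -> differentiable (phi \o f) p.
  by move=> Wp; have [] := derive_comp_scalar 0 (smooth_differentiable sf Wp) (dphi p Wp).
elim: m => [|m IH]; first by rewrite diff_upto0.
rewrite diff_uptoS; split=> // i.
have cX l : diff_upto m W (fun p => phi (f p) ^+ l).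
  elim: l => [|l IHl]; first exact: diff_upto_cst.
  have -> : (fun p => phi (f p) ^+ l.+1) = (fun p => phi (f p) * phi (f p) ^+ l).
    by apply/funext => p; rewrite exprS.
  exact: diff_uptoM.
apply: (@eq_on_diff_upto _ _ (fun p => (c * phi (f p) ^+ k) * pd i f p)) => //.
  move=> p Wp; symmetry.
  by have [] := derive_comp_scalar (delta_mx 0 i) (smooth_differentiable sf Wp) (dphi p Wp).
apply: diff_uptoM => //; last exact: (smooth_diff_upto _ _).1 (smooth_pd i sf) m.
by apply: diff_uptoM => //; apply: diff_upto_cst.
Qed.

Lemma smooth_expR W f : open W -> smooth_fun W f ->
  smooth_fun W (fun p => expR (f p)).
Proof.
move=> oW; apply: (@smooth_comp_ode _ expR 1 1) => // p _.
rewrite mul1r expr1; exact: is_derive_expR.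
Qed.

Lemma smooth_rsqrt W f : open W -> (forall p, W p -> 0 < f p) -> smooth_fun W f ->
  smooth_fun W (fun p => (Num.sqrt (f p))^-1).
Proof.
move=> oW f0; apply: (@smooth_comp_ode _ (fun x => (Num.sqrt x)^-1) (- 2^-1) 3) => //.
move=> p Wp; have fp := f0 p Wp.
have s0 : Num.sqrt (f p) != 0 by rewrite gt_eqF // sqrtr_gt0.
have [d1 d2] := is_derive1_sqrt fp.
have -> : - 2^-1 * (Num.sqrt (f p))^-1 ^+ 3 =
   - (Num.sqrt (f p)) ^- 2 *: (2 * Num.sqrt (f p))^-1.
  by rewrite /GRing.scale /=; field.
apply: DeriveDef; first exact: derivableV.
by rewrite deriveV // d2.
Qed.

Lemma is_derive_line f (p v : 'rV[R]_n) (s : R) :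
  differentiable f (p + s *: v) ->
  is_derive s 1 (fun t => f (p + t *: v)) ('D_v f (p + s *: v)).
Proof.
move=> df.
have dl : is_diff s (fun t : R => p + t *: v) (fun t => t *: v).
  have h1 : is_diff s (cst p : R -> 'rV[R]_n) 0 by exact: is_diff_cst.
  have h2 : is_diff s (fun t : R => t *: v) (fun t : R => t *: v).
    exact: is_diff_scalel.
  by have := is_diffD h1 h2; rewrite add0r.
have dc : differentiable (fun t : R => f (p + t *: v)) s.
  by apply: (@differentiable_comp _ _ _ _ (fun t : R => p + t *: v) f).
apply: DeriveDef; first exact: diff_derivable.
rewrite deriveE // (@diff_comp _ _ _ _ (fun t : R => p + t *: v) f) //=.
by rewrite diff_val scale1r deriveE.
Qed.

(** Two applications of the mean value theorem, first along [u] and then along [v]. The second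
    difference on the left is symmetric in [u] and [v], which is what forces mixed partial
    derivatives to agree in the limit. *)
Lemma mixed_difference f (p u v : 'rV[R]_n) (h : R) : 0 < h ->
  (forall s t, 0 <= s <= h -> 0 <= t <= h ->
     differentiable f (p + s *: u + t *: v) /\
     differentiable ('D_u f) (p + s *: u + t *: v)) ->
  exists s t, [/\ 0 <= s <= h, 0 <= t <= h &
    f (p + h *: u + h *: v) - f (p + h *: u) - (f (p + h *: v) - f p) =
    'D_v ('D_u f) (p + s *: u + t *: v) * h * h].
Proof.
move=> h0 df.
have h00 : 0 <= (0 : R) <= h by rewrite lexx ltW.
have hh : 0 <= h <= h by rewrite lexx ltW.
pose phi s := f (p + h *: v + s *: u) - f (p + s *: u).
pose dphi s := 'D_u f (p + h *: v + s *: u) - 'D_u f (p + s *: u).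
have dphiP s : 0 <= s <= h -> is_derive s 1 phi (dphi s).
  move=> sh; apply: is_deriveB; apply: is_derive_line.
    by rewrite addrAC; have [] := df s h sh hh.
  by have [] := df s 0 sh h00; rewrite scale0r addr0.
have [s /[!in_itv]/= /andP[s0 sh] sE] : exists2 s, s \in `]0, h[%R &
    phi h - phi 0 = dphi s * (h - 0).
  apply: (@MVT _ phi dphi 0 h h0).
    by move=> s /[!in_itv]/= /andP[s0 sh]; apply: dphiP; rewrite !ltW.
  apply: derivable_within_continuous => s /[!in_itv]/= sh.
  by have [] := dphiP s sh.
have s0h : 0 <= s <= h by rewrite !ltW.
pose psi t := 'D_u f (p + s *: u + t *: v).
have psiP t : 0 <= t <= h -> is_derive t 1 psi ('D_v ('D_u f) (p + s *: u + t *: v)).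
  by move=> th; apply: is_derive_line; have [] := df s t s0h th.
have [t /[!in_itv]/= /andP[t0 th] tE] : exists2 t, t \in `]0, h[%R &
    psi h - psi 0 = 'D_v ('D_u f) (p + s *: u + t *: v) * (h - 0).
  apply: (@MVT _ psi (fun t => 'D_v ('D_u f) (p + s *: u + t *: v)) 0 h h0).
    by move=> t /[!in_itv]/= /andP[t0 th]; apply: psiP; rewrite !ltW.
  apply: derivable_within_continuous => t /[!in_itv]/= th.
  by have [] := psiP t th.
exists s, t; split; rewrite ?ltW //.
move: sE tE; rewrite /phi /dphi /psi !subr0 !scale0r !addr0 => sE <-.
by rewrite [p + h *: u + _]addrAC sE [p + h *: v + _]addrAC.
Qed.

(* Schwarz's theorem *)
Lemma pd_comm W f i j p : open W -> smooth_fun W f -> W p ->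
  pd i (pd j f) p = pd j (pd i f) p.
Proof.
move=> oW sf Wp; apply/eqP; rewrite -subr_eq0 -normr_le0; apply/ler_addgt0Pr => e e0.
rewrite add0r.
have ca k l : {for p, continuous (pd k (pd l f))}.
  by apply/differentiable_continuous/(smooth_differentiable _ Wp)/smooth_pd/smooth_pd.
have e20 : 0 < e / 2 by rewrite divr_gt0.
have nW : nbhs p W by exact: open_nbhs_nbhs.
have n1 : \forall q \near p, `|pd i (pd j f) p - pd i (pd j f) q| < e / 2.
  by move/cvgrPdist_lt : (ca i j); apply.
have n2 : \forall q \near p, `|pd j (pd i f) p - pd j (pd i f) q| < e / 2.
  by move/cvgrPdist_lt : (ca j i); apply.
have [d /= d0 dP] : exists2 d : R, 0 < d & forall q, ball p d q ->
    [/\ W q, `|pd i (pd j f) p - pd i (pd j f) q| < e / 2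
      & `|pd j (pd i f) p - pd j (pd i f) q| < e / 2].
  have [d d0 dP] := (nbhs_ballP _ _).1 (filterI nW (filterI n1 n2)).
  by exists d => // q /dP[? [? ?]].
pose u : 'rV[R]_n := delta_mx 0 i; pose v : 'rV[R]_n := delta_mx 0 j.
pose N := `|u| + `|v| + 1.
have N0 : 0 < N by rewrite ltr_wpDl // addr_ge0.
pose h := d / 2 / N.
have h0 : 0 < h by rewrite !divr_gt0.
have inB s t : 0 <= s <= h -> 0 <= t <= h -> ball p d (p + s *: u + t *: v).
  move=> /andP[s0 sh] /andP[t0 th]; rewrite -ball_normE /= -addrA opprD addrA subrr.
  rewrite sub0r normrN (le_lt_trans (ler_normD _ _)) // !normrZ !ger0_norm //.
  have : s * `|u| + t * `|v| <= h * N.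
    rewrite /N !mulrDr mulr1 -[leLHS]addr0 lerD ?(ltW h0) // lerD //;
    exact: ler_wpM2r.
  move=> /le_lt_trans; apply; rewrite /h divfK ?gt_eqF //.
  by rewrite gtr_pMr // invf_lt1 // ltr1n.
have dd k q : W q -> differentiable f q /\ differentiable ('D_(delta_mx 0 k) f) q.
  move=> Wq; split; first exact: smooth_differentiable Wq.
  exact: (smooth_differentiable (smooth_pd k sf) Wq).
have [s [t [sh th E1]]] : exists s t, [/\ 0 <= s <= h, 0 <= t <= h &
    f (p + h *: u + h *: v) - f (p + h *: u) - (f (p + h *: v) - f p) =
    'D_v ('D_u f) (p + s *: u + t *: v) * h * h].
  apply: mixed_difference => // s t sh th; apply: dd.
  by have [] := dP _ (inB s t sh th).
have [t' [s' [th' sh' E2]]] : exists t s, [/\ 0 <= t <= h, 0 <= s <= h &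
    f (p + h *: v + h *: u) - f (p + h *: v) - (f (p + h *: u) - f p) =
    'D_u ('D_v f) (p + t *: v + s *: u) * h * h].
  apply: mixed_difference => // t' s' th' sh'; apply: dd.
  by have [] := dP _ (inB s' t' sh' th'); rewrite addrAC.
have E : pd j (pd i f) (p + s *: u + t *: v) = pd i (pd j f) (p + s' *: u + t' *: v).
  apply: (mulIf (lt0r_neq0 h0)); apply: (mulIf (lt0r_neq0 h0)).
  rewrite -[LHS]E1 [p + s' *: u + _]addrAC -[RHS]E2 [p + h *: u + h *: v]addrAC.
  by rewrite !opprB; ring.
have [_ _ F1] := dP _ (inB s t sh th).
have [_ F2 _] := dP _ (inB s' t' sh' th').
move: F1 F2; rewrite E; move: (pd i (pd j f) (p + _ + _)) => x F1 F2.
have -> : pd i (pd j f) p - pd j (pd i f) p =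
    (pd i (pd j f) p - x) - (pd j (pd i f) p - x).
  by rewrite opprB addrA subrK.
apply: (le_trans (ler_normB _ _)).
by rewrite [leRHS]splitr; apply: lerD; [exact: (ltW F2)|exact: (ltW F1)].
Qed.

End SmoothCalculus.

(** * Matrix-valued functions and inner products *)

Section MatrixCalculus.
Context {R : realType} {n : nat}.
Implicit Types (W U : set 'rV[R]_n) (f : 'rV[R]_n -> R) (p v : 'rV[R]_n).

Lemma derive_pd f p v : differentiable f p ->
  'D_v f p = \sum_i v 0 i * pd i f p.
Proof.
move=> df; rewrite deriveE // [in LHS](row_sum_delta v) linear_sum.
by apply: eq_bigr => i _; rewrite linearZ /= /pd deriveE.
Qed.

Definition diff_mx m k (F : 'rV[R]_n -> 'M[R]_(m, k)) p :=
  forall i j, differentiable (fun q => F q i j) p.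

Definition dmx m k (F : 'rV[R]_n -> 'M[R]_(m, k)) p v : 'M[R]_(m, k) :=
  \matrix_(i, j) 'D_v (fun q => F q i j) p.

Lemma smooth_diff_mx m k W (F : 'rV[R]_n -> 'M[R]_(m, k)) p :
  smooth_mx W F -> W p -> diff_mx F p.
Proof. by move=> sF Wp i j; apply: smooth_differentiable (sF i j) Wp. Qed.

Lemma diff_mx_tr m k (F : 'rV[R]_n -> 'M[R]_(m, k)) p :
  diff_mx F p -> diff_mx (fun q => (F q)^T) p.
Proof.
move=> dF i j; rewrite (_ : (fun q => _) = (fun q => F q j i)); first exact: dF.
by apply/funext => q; rewrite mxE.
Qed.

Lemma dmx_tr m k (F : 'rV[R]_n -> 'M[R]_(m, k)) p v :
  dmx (fun q => (F q)^T) p v = (dmx F p v)^T.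
Proof.
apply/matrixP => i j; rewrite !mxE.
by congr ('D_v _ p); apply/funext => q; rewrite mxE.
Qed.

Section Product.
Context {m k l : nat} (F : 'rV[R]_n -> 'M[R]_(m, k)) (H : 'rV[R]_n -> 'M[R]_(k, l)).
Variable p : 'rV[R]_n.
Hypotheses (dF : diff_mx F p) (dH : diff_mx H p).

Let entryE i j :
  (fun q => (F q *m H q) i j) = \sum_x (fun q => F q i x) * (fun q => H q x j).
Proof. by apply/funext => q; rewrite mxE fct_sumE. Qed.

Lemma diff_mxM : diff_mx (fun q => F q *m H q) p.
Proof.
move=> i j; rewrite entryE; apply: differentiable_sum => x.
exact: differentiableM.
Qed.

Lemma dmxM v : dmx (fun q => F q *m H q) p v = dmx F p v *m H p + F p *m dmx H p v.
Proof.
apply/matrixP => i j; rewrite 4!mxE entryE derive_sum; last first.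
  by move=> x; apply: derivableM; apply: diff_derivable.
rewrite -big_split; apply: eq_bigr => x _ /=; rewrite !mxE deriveM;
  try exact: diff_derivable.
by rewrite /GRing.scale /= addrC [H p x j * _]mulrC.
Qed.
End Product.

Lemma dmx_linear m k (F : 'rV[R]_n -> 'M[R]_(m, k)) p : diff_mx F p ->
  forall v, dmx F p v = \sum_i v 0 i *: dmx F p (delta_mx 0 i).
Proof.
move=> dF v; apply/matrixP => i j; rewrite mxE summxE derive_pd //.
by apply: eq_bigr => x _; rewrite !mxE.
Qed.

Lemma smooth_mxM m k l W (F : 'rV[R]_n -> 'M[R]_(m, k)) (H : 'rV[R]_n -> 'M[R]_(k, l)) :
  open W -> smooth_mx W F -> smooth_mx W H -> smooth_mx W (fun q => F q *m H q).
Proof.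
move=> oW sF sH i j.
rewrite (_ : (fun q => _) = (fun q => \sum_x F q i x * H q x j)).
  by apply: smooth_sum => // x; apply: smoothM.
by apply/funext => q; rewrite mxE.
Qed.

Lemma smooth_mx_tr m k W (F : 'rV[R]_n -> 'M[R]_(m, k)) :
  smooth_mx W F -> smooth_mx W (fun q => (F q)^T).
Proof.
move=> sF i j; rewrite (_ : (fun q => _) = (fun q => F q j i)); first exact: sF.
by apply/funext => q; rewrite mxE.
Qed.

Lemma smooth_mx_cst m k W (A : 'M[R]_(m, k)) : smooth_mx W (fun=> A).
Proof. by move=> i j; apply: smooth_cst. Qed.

Lemma smooth_mxB m k W (F H : 'rV[R]_n -> 'M[R]_(m, k)) : open W ->
  smooth_mx W F -> smooth_mx W H -> smooth_mx W (fun q => F q - H q).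
Proof.
move=> oW sF sH i j.
rewrite (_ : (fun q => _) = (fun q => F q i j - H q i j)); first exact: smoothB.
by apply/funext => q; rewrite !mxE.
Qed.

Lemma smooth_mxZ m k W (c : 'rV[R]_n -> R) (F : 'rV[R]_n -> 'M[R]_(m, k)) : open W ->
  smooth_fun W c -> smooth_mx W F -> smooth_mx W (fun q => c q *: F q).
Proof.
move=> oW sc sF i j.
rewrite (_ : (fun q => _) = (fun q => c q * F q i j)); first exact: smoothM.
by apply/funext => q; rewrite !mxE.
Qed.

Lemma smooth_inner W (g : 'rV[R]_n -> 'M[R]_n) X Y : open W -> smooth_mx W g ->
  smooth_mx W X -> smooth_mx W Y -> smooth_fun W (fun q => inner g q (X q) (Y q)).
Proof.
move=> oW sg sX sY; apply: smooth_mxM => //; last exact: smooth_mx_tr.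
exact: smooth_mxM.
Qed.

Lemma smooth_mx_sub m k U W (F : 'rV[R]_n -> 'M[R]_(m, k)) :
  U `<=` W -> smooth_mx W F -> smooth_mx U F.
Proof. by move=> UW sF i j; apply: smooth_sub (sF i j). Qed.

End MatrixCalculus.

Section Inner.
Context {R : realType} {n : nat} (g : 'rV[R]_n -> 'M[R]_n).
Variable p : 'rV[R]_n.
Hypothesis g_sym : (g p)^T = g p.
Hypothesis g_pos : forall u, u != 0 -> 0 < inner g p u u.
Local Notation "<< u , v >>" := (inner g p u v).

Lemma innerDl u1 u2 v : <<u1 + u2, v>> = <<u1, v>> + <<u2, v>>.
Proof. by rewrite /inner !mulmxDl mxE. Qed.
Lemma innerZl a u v : <<a *: u, v>> = a * <<u, v>>.
Proof. by rewrite /inner -!scalemxAl mxE. Qed.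
Lemma innerC u v : <<u, v>> = <<v, u>>.
Proof.
rewrite /inner -[LHS]/((u *m g p *m v^T) 0 0).
have -> : u *m g p *m v^T = (v *m g p *m u^T)^T.
  by rewrite !trmx_mul trmxK g_sym mulmxA.
by rewrite mxE.
Qed.
Lemma innerDr u v1 v2 : <<u, v1 + v2>> = <<u, v1>> + <<u, v2>>.
Proof. by rewrite innerC innerDl !(innerC u). Qed.
Lemma innerZr a u v : <<u, a *: v>> = a * <<u, v>>.
Proof. by rewrite innerC innerZl (innerC u). Qed.
Lemma innerNl u v : <<- u, v>> = - <<u, v>>.
Proof. by rewrite -scaleN1r innerZl mulN1r. Qed.
Lemma inner_eq0 u : <<u, u>> = 0 -> u = 0.
Proof. by move=> uu; apply/eqP; apply: contra_eqT uu => /g_pos; rewrite lt0r => /andP[]. Qed.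

Lemma metric_unitmx : g p \in unitmx.
Proof.
rewrite -row_free_unit; apply: inj_row_free => u ug; apply: inner_eq0.
by rewrite /inner ug mul0mx mxE.
Qed.

Variable D : 'rV[R]_n -> 'M[R]_n.

Lemma orth_inner u v : (u <= orth g D p)%MS -> (v <= D p)%MS -> <<u, v>> = 0.
Proof.
move=> /sub_kermxP uD /submxP [w ->].
by rewrite /inner trmx_mul mulmxA -(mulmxA u) uD mul0mx mxE.
Qed.

Lemma capmx_orth : (D p :&: orth g D p)%MS = 0.
Proof.
apply/eqP/rowV0P => u; rewrite sub_capmx => /andP[uD uo].
by apply: inner_eq0; apply: orth_inner.
Qed.

Lemma addsmx_orth (u : 'rV[R]_n) : (u <= D p + orth g D p)%MS.
Proof.
apply: submx_full; rewrite /row_full mxrank_disjoint_sum ?capmx_orth //.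
rewrite mxrank_ker eqmxMfull ?row_full_unit ?metric_unitmx // mxrank_tr.
by rewrite subnKC // rank_leq_row.
Qed.

Lemma orth_proj_compl u : (u - orth_proj g D p u <= orth g D p)%MS.
Proof. by apply: proj_mx_compl_sub; apply: addsmx_orth. Qed.

End Inner.

(** * The Lie derivative of the metric *)

Section LieDerivative.
Context {R : realType} {n : nat} (g : 'rV[R]_n -> 'M[R]_n).
Implicit Types (p u v w : 'rV[R]_n) (X Y T : 'rV[R]_n -> 'rV[R]_n).

Definition dmetric p w u v : R := (u *m dmx g p w *m v^T) 0 0.

(** The coordinate expression of (L_T g)(u, v), which is free of Christoffel symbols. *)
Definition lie_metric T p u v : R :=
  dmetric p (T p) u v + inner g p (dmx T p u) v + inner g p u (dmx T p v).

Definition gamma p u v : 'rV[R]_n :=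
  \row_k \sum_i \sum_j christoffel g k i j p * u 0 i * v 0 j.

Lemma nablaE X Y p : nabla g X Y p = dmx Y p (X p) + gamma p (X p) (Y p).
Proof. by apply/rowP => k; rewrite !mxE. Qed.

Lemma dmxD m k (F : 'rV[R]_n -> 'M[R]_(m, k)) p u v : diff_mx F p ->
  dmx F p (u + v) = dmx F p u + dmx F p v.
Proof.
move=> dF; rewrite !(dmx_linear dF) -big_split; apply: eq_bigr => i _ /=.
by rewrite mxE scalerDl.
Qed.

Lemma dmxZ m k (F : 'rV[R]_n -> 'M[R]_(m, k)) p a u : diff_mx F p ->
  dmx F p (a *: u) = a *: dmx F p u.
Proof.
move=> dF; rewrite !(dmx_linear dF) scaler_sumr; apply: eq_bigr => i _ /=.
by rewrite mxE scalerA.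
Qed.

Lemma dmetricDl p w u1 u2 v :
  dmetric p w (u1 + u2) v = dmetric p w u1 v + dmetric p w u2 v.
Proof. by rewrite /dmetric !mulmxDl mxE. Qed.

Lemma dmetricZl p w a u v : dmetric p w (a *: u) v = a * dmetric p w u v.
Proof. by rewrite /dmetric -!scalemxAl mxE. Qed.

Section At.
Variables (U : set 'rV[R]_n) (p : 'rV[R]_n).
Hypotheses (oU : open U) (Up : U p) (gU : riemannian_metric g U).

Let g_sym : (g p)^T = g p. Proof. by case: gU => _ gs _; apply: gs. Qed.
Let g_pos u : u != 0 -> 0 < inner g p u u.
Proof. by case: gU => _ _ gp; apply: gp. Qed.
Let dg : diff_mx g p.
Proof. by case: gU => sg _ _; apply: smooth_diff_mx Up. Qed.

Lemma dmetricC w u v : dmetric p w u v = dmetric p w v u.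
Proof.
have dgT : (dmx g p w)^T = dmx g p w.
  rewrite -dmx_tr; apply/matrixP => i j; rewrite !mxE.
  by apply: eq_on_derive oU Up _ => q Uq; case: gU => _ -> //.
rewrite /dmetric; have -> : u *m dmx g p w *m v^T = (v *m dmx g p w *m u^T)^T.
  by rewrite !trmx_mul trmxK dgT mulmxA.
by rewrite mxE.
Qed.

Lemma derive_inner X Y v : diff_mx X p -> diff_mx Y p ->
  'D_v (fun q => inner g q (X q) (Y q)) p =
  inner g p (dmx X p v) (Y p) + dmetric p v (X p) (Y p) + inner g p (X p) (dmx Y p v).
Proof.
move=> dX dY.
transitivity (dmx (fun q => X q *m g q *m (Y q)^T) p v 0 0); first by rewrite mxE.
have dXg : diff_mx (fun q => X q *m g q) p by apply: diff_mxM.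
rewrite dmxM //; last exact: diff_mx_tr.
by rewrite dmxM // dmx_tr mulmxDl [LHS]mxE [X in X + _ = _]mxE.
Qed.

Lemma inner_gamma u v w : inner g p (gamma p u v) w =
  2^-1 * (dmetric p u v w + dmetric p v u w - dmetric p w u v).
Proof.
(* [c] is twice the covector <gamma p u v, .>: lowering the index cancels the inverse metric in the
   Christoffel symbols. *)
pose c : 'rV[R]_n := v *m dmx g p u + u *m dmx g p v
  - \row_l \sum_i \sum_j pd l (fun q => g q i j) p * u 0 i * v 0 j.
have gE : gamma p u v = 2^-1 *: (c *m invmx (g p)).
  apply/rowP => k; rewrite [LHS]mxE 2!mxE.
  rewrite (eq_bigr (fun i => 2^-1 * \sum_j \sum_l invmx (g p) k l *
    (pd i (fun q => g q j l) p + pd j (fun q => g q i l) p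
     - pd l (fun q => g q i j) p) * u 0 i * v 0 j)); last first.
    move=> i _; rewrite mulr_sumr; apply: eq_bigr => j _.
    rewrite /christoffel -[LHS]mulrA -[LHS]mulrA; congr (_ * _).
    by rewrite mulr_suml; apply: eq_bigr => l _; rewrite !mulrA.
  rewrite -mulr_sumr; congr (_ * _).
  under eq_bigr do rewrite exchange_big.
  rewrite exchange_big /=; apply: eq_bigr => l _.
  have <- : invmx (g p) k l = invmx (g p) l k.
    by rewrite -[in RHS](g_sym) -trmx_inv mxE.
  rewrite [RHS]mulrC.
  rewrite (eq_bigr (fun i => invmx (g p) k l * \sum_j
    (pd i (fun q => g q j l) p + pd j (fun q => g q i l) p
     - pd l (fun q => g q i j) p) * u 0 i * v 0 j)); last first.
    by move=> i _; rewrite mulr_sumr; apply: eq_bigr => j _; rewrite !mulrA.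
  rewrite -mulr_sumr; congr (_ * _); rewrite !mxE.
  under eq_bigr do under eq_bigr do rewrite !mulrBl !mulrDl.
  under eq_bigr do rewrite sumrB big_split.
  rewrite sumrB big_split /=; congr (_ + _ - _).
    rewrite exchange_big; apply: eq_bigr => j _ /=.
    rewrite mxE derive_pd // mulr_sumr; apply: eq_bigr => i _; ring.
  apply: eq_bigr => j _ /=.
  rewrite mxE derive_pd // mulr_sumr; apply: eq_bigr => i _; ring.
rewrite /inner gE -scalemxAl mulmxKV ?metric_unitmx // -scalemxAl mxE; congr (_ * _).
rewrite /c !mulmxDl mulNmx [LHS]mxE [X in X + _ = _]mxE [X in _ + X = _]mxE.
congr (_ + _ - _).
rewrite /dmetric (dmx_linear dg) [LHS]mxE.
under eq_bigr do rewrite mxE [w^T _ _]mxE mulrC.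
rewrite mulmx_sumr mulmx_suml summxE; apply: eq_bigr => l _.
rewrite -scalemxAr -scalemxAl mxE; congr (_ * _).
rewrite mxE exchange_big /=; apply: eq_bigr => j _.
rewrite !mxE mulr_suml; apply: eq_bigr => i _; rewrite mxE /pd; ring.
Qed.

(** In invariant terms (L_T g)(T, v) = <nabla_T T, v> + <T, nabla_v T>, and the last term is half
    the derivative of the constant <T, T>. *)
Lemma inner_nabla_geodesic T v : smooth_mx U T ->
  (forall q, U q -> inner g q (T q) (T q) = 1) ->
  inner g p (nabla g T T p) v = lie_metric T p (T p) v.
Proof.
move=> sT T1; have dT := smooth_diff_mx sT Up.
have := derive_inner v dT dT.
rewrite (eq_on_derive (h := fun=> 1) v oU Up T1) derive_cst => E.
rewrite nablaE innerDl inner_gamma /lie_metric.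
move: E; rewrite (innerC g_sym (T p)) => E.
have -> : dmetric p v (T p) (T p) = - 2 * inner g p (dmx T p v) (T p) by lra.
lra.
Qed.

(** Differentiating <X, T> = 0 and <Y, T> = 0 moves the derivatives onto T: <nabla_X Y, T> = - <Y,
    nabla_X T>, and likewise with X and Y exchanged. *)
Lemma inner_nabla_sym X Y T : smooth_mx U X -> smooth_mx U Y -> smooth_mx U T ->
  (forall q, U q -> inner g q (X q) (T q) = 0) ->
  (forall q, U q -> inner g q (Y q) (T q) = 0) ->
  inner g p (nabla g X Y p + nabla g Y X p) (T p) = - lie_metric T p (X p) (Y p).
Proof.
move=> sX sY sT XT YT.
have dT := smooth_diff_mx sT Up.
have dX := smooth_diff_mx sX Up.
have dY := smooth_diff_mx sY Up.
have := derive_inner (X p) dY dT; have := derive_inner (Y p) dX dT.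
rewrite (eq_on_derive (h := fun=> 0) _ oU Up XT) derive_cst => E1.
rewrite (eq_on_derive (h := fun=> 0) _ oU Up YT) derive_cst => E2.
rewrite !nablaE !innerDl !inner_gamma /lie_metric.
rewrite (dmetricC (T p) (Y p)) (innerC g_sym (dmx T p (X p))).
have arith (a1 a2 b1 b2 c1 c2 e : R) : 0 = a1 + b1 + c1 -> 0 = a2 + b2 + c2 ->
    a2 + 2^-1 * (b2 + b1 - e) + (a1 + 2^-1 * (b1 + b2 - e)) = - (e + c2 + c1).
  move=> h1 h2; transitivity ((a1 + b1 + c1) + (a2 + b2 + c2) - (e + c2 + c1)).
    by field.
  by rewrite -h1 -h2 !add0r.
exact: arith E1 E2.
Qed.

End At.

Section ShearFree.
Variables (W U : set 'rV[R]_n) (D : 'rV[R]_n -> 'M[R]_n) (T : 'rV[R]_n -> 'rV[R]_n).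
Hypotheses (oU : open U) (UW : U `<=` W) (gU : riemannian_metric g U).
Hypotheses (sT : smooth_mx U T) (T1 : forall q, U q -> inner g q (T q) (T q) = 1).
Hypothesis DT : forall q, U q -> (D q == T q)%MS.

Let gs q : U q -> (g q)^T = g q. Proof. by case: gU => _ + _; apply. Qed.
Let gp q u : U q -> u != 0 -> 0 < inner g q u u.
Proof. by case: gU => _ _ + Uq; apply. Qed.

Lemma sub_orthE q (u : 'rV[R]_n) : U q ->
  (u <= orth g D q)%MS = (inner g q u (T q) == 0).
Proof.
move=> Uq; rewrite /orth sub_kermx; have /andP[/submxP[E DE] TD] := DT Uq.
apply/eqP/eqP => [uD|uT].
  by apply: orth_inner TD; apply/sub_kermxP.
rewrite DE trmx_mul !mulmxA (_ : u *m g q *m (T q)^T = 0) ?mul0mx //.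
by apply/matrixP => i j; rewrite !ord1 [RHS]mxE.
Qed.

(** L_T g splits into three blocks along T and its complement: the T-T block vanishes by unit
    length, the mixed block because the foliation is geodesic, and conformality makes the remaining
    one a multiple of g. *)
Lemma lie_metric_shear_free p : U p -> conformal g W D -> totally_geodesic g W D ->
  exists rho : R, forall u v, lie_metric T p u v =
    2 * rho * (inner g p u v - inner g p u (T p) * inner g p v (T p)).
Proof.
move=> Up [V [_ conf]] geod; have dT := smooth_diff_mx sT Up.
(* The hypotheses speak of local sections; projecting the constant coordinate field [v] off T gives
   enough sections of the complement to fill it at every point. *)
pose hor v q := v - inner g q v (T q) *: T q.
have shor v : smooth_mx U (hor v).
  apply: smooth_mxB => //; first exact: smooth_mx_cst.
  apply: smooth_mxZ => //; apply: smooth_inner => //; last exact: smooth_mx_cst.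
  by case: gU.
have horT v q : U q -> inner g q (hor v q) (T q) = 0.
  by move=> Uq; rewrite /hor innerDl innerNl innerZl T1 // mulr1 subrr.
have hor_sec v : section_on U (orth g D) (hor v).
  by split=> // q Uq; rewrite sub_orthE // horT.
have T_sec : section_on U D T by split=> // q /DT /andP[].
(* For X, Y orthogonal to T, conformality reads nabla_X Y + nabla_Y X = 2 g(X,Y) V up to a term
   orthogonal to T, while its product with T is - (L_T g)(X,Y); hence rho = - <V, T>. *)
exists (- inner g p (V p) (T p)) => u v.
have lieC x y : lie_metric T p x y = lie_metric T p y x.
  rewrite /lie_metric (dmetricC oU Up gU) (innerC (gs Up) x) (innerC (gs Up) y); ring.
have lieD x y z : lie_metric T p (x + y) z = lie_metric T p x z + lie_metric T p y z.
  have arith (a b c d e f : R) : a + b + (c + d) + (e + f) = a + c + e + (b + d + f) by ring.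
  by rewrite /lie_metric dmetricDl dmxD // !innerDl; exact: arith.
have lieZ a x z : lie_metric T p (a *: x) z = a * lie_metric T p x z.
  rewrite /lie_metric dmetricZl dmxZ // !innerZl; ring.
have lieT x : lie_metric T p (T p) (hor x p) = 0.
  rewrite -(inner_nabla_geodesic oU Up gU _ sT T1).
  have /eqP := geod U T T oU UW T_sec T_sec p Up.
  rewrite /second_form scaler_eq0 invr_eq0 pnatr_eq0 /= => /eqP pr0.
  (* A vector whose projection to [orth D] vanishes lies in [orth (orth D)], so it is orthogonal to
     every [hor x p]. *)
  have := orth_proj_compl (fun u => @gp p u Up) (orth g D)
    (nabla g T T p + nabla g T T p).
  rewrite pr0 subr0 => /orth_inner/(_ ((hor_sec x).2 p Up)).
  rewrite innerDl; lra.
have lieTT : lie_metric T p (T p) (T p) = 0.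
  rewrite /lie_metric; have := derive_inner Up gU (T p) dT dT.
  by rewrite (eq_on_derive (h := fun=> 1) _ oU Up T1) derive_cst; lra.
have lie_hor x y : lie_metric T p (hor x p) (hor y p) =
    2 * - inner g p (V p) (T p) * inner g p (hor x p) (hor y p).
  have hT z q : U q -> inner g q (hor z q) (T q) = 0 by exact: horT.
  rewrite -[LHS]opprK -(inner_nabla_sym oU Up gU (shor x) (shor y) sT (hT x) (hT y)).
  have E := conf U _ _ oU UW (hor_sec x) (hor_sec y) p Up.
  have := orth_proj_compl (fun u => @gp p u Up) (orth g (orth g D))
    (nabla g (hor x) (hor y) p + nabla g (hor y) (hor x) p).
  set N := nabla _ _ _ _ + _ in E *.
  have -> : orth_proj g (orth g (orth g D)) p N =
      (2 * inner g p (hor x p) (hor y p)) *: V p.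
    by rewrite -scalerA -E /second_form scalerA mulfV ?pnatr_eq0 // scale1r.
  (* The projection in [second_form (orth D)] has image [orth (orth D)], and its error term is
     orthogonal to that image. Since T lies in the image, the error does not affect the product with
     T. *)
  have To : (T p <= orth g (orth g D) p)%MS.
    have OT : orth g D p *m g p *m (T p)^T = 0.
      have rowO i : inner g p (row i (orth g D p)) (T p) = 0.
        by have /andP[_ TD] := DT Up; apply: orth_inner TD; apply: row_sub.
      move: (orth g D p) rowO => O rowO; apply/row_matrixP => i.
      rewrite row0 !row_mul; apply/rowP => j; rewrite ord1 [RHS]mxE; exact: rowO.
    apply/sub_kermxP; apply: trmx_inj.
    by rewrite trmx_mul [X in X *m _]trmx_mul trmxK trmx0 (gs Up).
  move=> /orth_inner /(_ To); rewrite innerDl innerNl innerZl => /eqP.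
  rewrite subr_eq0 => /eqP ->; ring.
have horE x : x = hor x p + inner g p x (T p) *: T p by rewrite subrK.
have -> : lie_metric T p u v = lie_metric T p (hor u p) (hor v p).
  have lieT0 : lie_metric T p (T p) v = 0.
    by rewrite lieC (horE v) lieD lieZ lieTT lieC lieT mulr0 addr0.
  rewrite [in LHS](horE u) lieD lieZ lieT0 mulr0 addr0 lieC.
  by rewrite [in LHS](horE v) lieD lieZ lieT mulr0 addr0 lieC.
rewrite lie_hor; congr (_ * _).
rewrite [hor u p]/hor innerDl innerNl innerZl (innerC (gs Up) (T p)) horT // mulr0 subr0.
rewrite innerC ?gs // /hor innerDl innerNl innerZl (innerC (gs Up) v u).
by rewrite (innerC (gs Up) (T p) u) mulrC.
Qed.

End ShearFree.
End LieDerivative.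

(** * Pointwise algebra of the integrability conditions *)

Section Riccati.
Variables (R : realFieldType) (p k c t1 t2 t3 rho w : R).

(* [grad_ij] is the derivative of t_j along e_i: in terms of the Levi-Civita connection,
   <nabla_i T, e_j> = rho (delta_ij - t_i t_j) + w eps_ijk t_k, to which the connection
   coefficients of the frame [e1,e2] = p e2, [e1,e3] = 2k e2 - c e3, [e2,e3] = 0 are added. *)
Definition grad11 := rho * (1 - t1 ^+ 2).
Definition grad12 := - rho * t1 * t2 + w * t3 - k * t3.
Definition grad13 := - rho * t1 * t3 - w * t2 + k * t2.
Definition grad21 := - rho * t1 * t2 - w * t3 - p * t2 - k * t3.
Definition grad22 := rho * (1 - t2 ^+ 2) + p * t1.
Definition grad23 := - rho * t2 * t3 + w * t1 + k * t1.
Definition grad31 := - rho * t1 * t3 + w * t2 - k * t2 + c * t3.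
Definition grad32 := - rho * t2 * t3 - w * t1 + k * t1.
Definition grad33 := rho * (1 - t3 ^+ 2) - c * t1.

(* the differential of [grad_ij] in a direction along which rho, w, t1, t2, t3 have the
   derivatives r, o, x1, x2, x3 *)
Definition dgrad11 (r o x1 x2 x3 : R) := r * (1 - t1 ^+ 2) - rho * (2 * t1 * x1).
Definition dgrad12 (r o x1 x2 x3 : R) :=
  - r * t1 * t2 - rho * (x1 * t2 + t1 * x2) + (o * t3 + w * x3) - k * x3.
Definition dgrad13 (r o x1 x2 x3 : R) :=
  - r * t1 * t3 - rho * (x1 * t3 + t1 * x3) - (o * t2 + w * x2) + k * x2.
Definition dgrad21 (r o x1 x2 x3 : R) :=
  - r * t1 * t2 - rho * (x1 * t2 + t1 * x2) - (o * t3 + w * x3) - p * x2 - k * x3.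
Definition dgrad22 (r o x1 x2 x3 : R) := r * (1 - t2 ^+ 2) - rho * (2 * t2 * x2) + p * x1.
Definition dgrad23 (r o x1 x2 x3 : R) :=
  - r * t2 * t3 - rho * (x2 * t3 + t2 * x3) + (o * t1 + w * x1) + k * x1.
Definition dgrad31 (r o x1 x2 x3 : R) :=
  - r * t1 * t3 - rho * (x1 * t3 + t1 * x3) + (o * t2 + w * x2) - k * x2 + c * x3.
Definition dgrad32 (r o x1 x2 x3 : R) :=
  - r * t2 * t3 - rho * (x2 * t3 + t2 * x3) - (o * t1 + w * x1) + k * x1.
Definition dgrad33 (r o x1 x2 x3 : R) := r * (1 - t3 ^+ 2) - rho * (2 * t3 * x3) - c * x1.

Variables r1 r2 r3 o1 o2 o3 : R.
Hypothesis t_unit : t1 ^+ 2 = 1 - t2 ^+ 2 - t3 ^+ 2.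
Local Notation D1 dF := (dF r1 o1 grad11 grad12 grad13).
Local Notation D2 dF := (dF r2 o2 grad21 grad22 grad23).
Local Notation D3 dF := (dF r3 o3 grad31 grad32 grad33).

(** T(rho) + rho^2 - w^2 is minus the sectional curvature of the planes containing T, and k^2 + p c
    is the sectional curvature of the plane of e2 and e3. By the Riccati equation the sum is the
    factor by which Ric - Ric(e1,e1) g is a multiple of g on the complement of T. *)
Definition riccati_trace := t1 * r1 + t2 * r2 + t3 * r3 + rho ^+ 2 - w ^+ 2 + k ^+ 2 + p * c.

Ltac unf := rewrite /riccati_trace /dgrad11 /dgrad12 /dgrad13 /dgrad21 /dgrad22 /dgrad23 /dgrad31 /dgrad32 /dgrad33
  /grad11 /grad12 /grad13 /grad21 /grad22 /grad23 /grad31 /grad32 /grad33.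

(* The coefficients p^2 + pc, c^2 + pc + 4k^2 and -2pk below are, in this order, the
   entries 33, 22 and 23 of Ric - Ric(e1,e1) g; this block is positive definite since
   its determinant is p c ((p + c)^2 + 4k^2). *)
Lemma riccati22 :
  D1 dgrad22 - D2 dgrad12 = p * grad22 -> D2 dgrad32 - D3 dgrad22 = 0 ->
  (p ^+ 2 + p * c) * t1 ^+ 2 = riccati_trace * (1 - t2 ^+ 2).
Proof.
move=> e1 e2.
(* This is the sum over i of t_i times the commutator relation of e_i and e2 applied to t2. In it
   rho is differentiated only along T, and the derivatives of w cancel. *)
have E : t1 * (D1 dgrad22 - D2 dgrad12 - p * grad22) - t3 * (D2 dgrad32 - D3 dgrad22) = 0.
  by rewrite e1 e2 subrr !mulr0 subrr.
apply/eqP; rewrite -subr_eq0 -oppr_eq0 -[X in X == 0]addr0 -[X in _ + X]oppr0 -{1}E.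
apply/eqP; unf; ring: t_unit.
Qed.

Lemma riccati33 :
  D1 dgrad33 - D3 dgrad13 = 2 * k * grad23 - c * grad33 -> D2 dgrad33 - D3 dgrad23 = 0 ->
  (c ^+ 2 + p * c + 4 * k ^+ 2) * t1 ^+ 2 = riccati_trace * (1 - t3 ^+ 2).
Proof.
move=> e1 e2.
have E : t1 * (D1 dgrad33 - D3 dgrad13 - (2 * k * grad23 - c * grad33)) + t2 * (D2 dgrad33 - D3 dgrad23) = 0.
  by rewrite e1 e2 subrr !mulr0 addr0.
apply/eqP; rewrite -subr_eq0 -oppr_eq0 -[X in X == 0]addr0 -[X in _ + X]oppr0 -{1}E.
apply/eqP; unf; ring: t_unit.
Qed.

Lemma riccati23 :
  D1 dgrad23 - D2 dgrad13 = p * grad23 -> D2 dgrad33 - D3 dgrad23 = 0 ->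
  D1 dgrad32 - D3 dgrad12 = 2 * k * grad22 - c * grad32 -> D2 dgrad32 - D3 dgrad22 = 0 ->
  - 2 * p * k * t1 ^+ 2 = riccati_trace * (t2 * t3).
Proof.
move=> e1 e2 e3 e4.
(* The contractions for the index pairs (2,3) and (3,2) are added because T(w) enters them with
   opposite signs; their sum is twice the desired identity. *)
have E : t1 * (D1 dgrad23 - D2 dgrad13 - p * grad23) - t3 * (D2 dgrad33 - D3 dgrad23) +
   t1 * (D1 dgrad32 - D3 dgrad12 - (2 * k * grad22 - c * grad32)) + t2 * (D2 dgrad32 - D3 dgrad22) = 0.
  by rewrite e1 e2 e3 e4 !subrr !mulr0 subrr !addr0.
apply: (@mulfI _ 2%:R); first by rewrite pnatr_eq0.
apply/eqP; rewrite -subr_eq0 -[X in X == 0]addr0 -[X in _ + X]oppr0 -{1}E.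
apply/eqP; unf; ring: t_unit.
Qed.

Lemma riccati11 :
  D1 dgrad21 - D2 dgrad11 = p * grad21 -> D1 dgrad31 - D3 dgrad11 = 2 * k * grad21 - c * grad31 ->
  (c ^+ 2 + p * c + 4 * k ^+ 2) * t3 ^+ 2 + 4 * p * k * (t2 * t3)
  + (p ^+ 2 + p * c) * t2 ^+ 2 = riccati_trace * (1 - t1 ^+ 2).
Proof.
move=> e1 e2.
have E : t2 * (D1 dgrad21 - D2 dgrad11 - p * grad21) +
    t3 * (D1 dgrad31 - D3 dgrad11 - (2 * k * grad21 - c * grad31)) = 0.
  by rewrite e1 e2 !subrr !mulr0 addr0.
apply/eqP; rewrite -subr_eq0 -[X in X == 0]addr0 -[X in _ + X]oppr0 -{1}E.
apply/eqP; unf; ring: t_unit.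
Qed.

End Riccati.

(* [ei_jk] stands for the derivative along the i-th frame field of [d_jk], itself the
   derivative of t_k along the j-th one. *)
Lemma riccati_relations (R : realFieldType) (p k c t1 t2 t3 rho w r1 r2 r3 o1 o2 o3 : R)
  (d11 d12 d13 d21 d22 d23 d31 d32 d33 : R)
  (e1_21 e2_11 e1_22 e2_12 e1_23 e2_13 e1_31 e3_11 e1_32 e3_12 e1_33 e3_13 e2_32 e3_22 e2_33 e3_23 : R) :
  t1 ^+ 2 = 1 - t2 ^+ 2 - t3 ^+ 2 ->
  d11 = grad11 t1 rho ->
  d12 = grad12 k t1 t2 t3 rho w ->
  d13 = grad13 k t1 t2 t3 rho w ->
  d21 = grad21 p k t1 t2 t3 rho w ->
  d22 = grad22 p t1 t2 rho ->
  d23 = grad23 k t1 t2 t3 rho w ->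
  d31 = grad31 k c t1 t2 t3 rho w ->
  d32 = grad32 k t1 t2 t3 rho w ->
  d33 = grad33 c t1 t3 rho ->
  e1_21 = dgrad21 p k t1 t2 t3 rho w r1 o1 d11 d12 d13 ->
  e2_11 = dgrad11 t1 rho r2 o2 d21 d22 d23 ->
  e1_22 = dgrad22 p t2 rho r1 o1 d11 d12 d13 ->
  e2_12 = dgrad12 k t1 t2 t3 rho w r2 o2 d21 d22 d23 ->
  e1_23 = dgrad23 k t1 t2 t3 rho w r1 o1 d11 d12 d13 ->
  e2_13 = dgrad13 k t1 t2 t3 rho w r2 o2 d21 d22 d23 ->
  e1_31 = dgrad31 k c t1 t2 t3 rho w r1 o1 d11 d12 d13 ->
  e3_11 = dgrad11 t1 rho r3 o3 d31 d32 d33 ->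
  e1_32 = dgrad32 k t1 t2 t3 rho w r1 o1 d11 d12 d13 ->
  e3_12 = dgrad12 k t1 t2 t3 rho w r3 o3 d31 d32 d33 ->
  e1_33 = dgrad33 c t3 rho r1 o1 d11 d12 d13 ->
  e3_13 = dgrad13 k t1 t2 t3 rho w r3 o3 d31 d32 d33 ->
  e2_32 = dgrad32 k t1 t2 t3 rho w r2 o2 d21 d22 d23 ->
  e3_22 = dgrad22 p t2 rho r3 o3 d31 d32 d33 ->
  e2_33 = dgrad33 c t3 rho r2 o2 d21 d22 d23 ->
  e3_23 = dgrad23 k t1 t2 t3 rho w r3 o3 d31 d32 d33 ->
  e1_21 - e2_11 = p * d21 -> e1_22 - e2_12 = p * d22 -> e1_23 - e2_13 = p * d23 ->
  e1_31 - e3_11 = 2 * k * d21 - c * d31 -> e1_32 - e3_12 = 2 * k * d22 - c * d32 ->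
  e1_33 - e3_13 = 2 * k * d23 - c * d33 ->
  e2_32 - e3_22 = 0 -> e2_33 - e3_23 = 0 ->
  exists l : R,
  [/\ (p ^+ 2 + p * c) * t1 ^+ 2 = l * (1 - t2 ^+ 2),
      (c ^+ 2 + p * c + 4 * k ^+ 2) * t1 ^+ 2 = l * (1 - t3 ^+ 2),
      - 2 * p * k * t1 ^+ 2 = l * (t2 * t3)
    & (c ^+ 2 + p * c + 4 * k ^+ 2) * t3 ^+ 2 - 2 * (- 2 * p * k) * (t2 * t3)
      + (p ^+ 2 + p * c) * t2 ^+ 2 = l * (1 - t1 ^+ 2)].
Proof.
move=> tu -> -> -> -> -> -> -> -> -> -> -> -> -> -> -> -> -> -> -> -> -> -> -> -> ->.
move=> C1 C2 C3 D1 D2 D3 E2 E3.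
exists (riccati_trace p k c t1 t2 t3 rho w r1 r2 r3); split.
- exact: (riccati22 tu C2 E2).
- exact: (riccati33 tu D3 E3).
- exact: (riccati23 tu C3 E3 D2 E2).
- rewrite -(riccati11 tu C1 D1); ring.
Qed.

Lemma eq_of_half (R : realFieldType) (a b x y : R) :
  x = y -> a - b = 2^-1 * (x - y) -> a = b.
Proof. by move=> ->; rewrite subrr mulr0 => /eqP; rewrite subr_eq0 => /eqP. Qed.

(** * The gradient of T from the shear-free equations: expansion and twist *)

Section FirstOrder.
Variables (R : realFieldType) (p k c t1 t2 t3 rho : R).
Variables d11 d12 d13 d21 d22 d23 d31 d32 d33 : R.
Hypothesis t_unit : t1 ^+ 2 = 1 - t2 ^+ 2 - t3 ^+ 2.
Hypothesis unit1 : t1 * d11 + t2 * d12 + t3 * d13 = 0.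
Hypothesis unit2 : t1 * d21 + t2 * d22 + t3 * d23 = 0.
Hypothesis unit3 : t1 * d31 + t2 * d32 + t3 * d33 = 0.
Hypothesis sym11 : d11 = rho * (1 - t1 ^+ 2).
Hypothesis sym22 : d22 - p * t1 = rho * (1 - t2 ^+ 2).
Hypothesis sym33 : d33 + c * t1 = rho * (1 - t3 ^+ 2).
Hypothesis sym12 : d12 + d21 + p * t2 + 2 * k * t3 = - 2 * rho * t1 * t2.
Hypothesis sym13 : d13 + d31 - c * t3 = - 2 * rho * t1 * t3.
Hypothesis sym23 : d23 + d32 - 2 * k * t1 = - 2 * rho * t2 * t3.

(* The first-order equations say that L_T g = 2 rho (g - T^b (x) T^b) in the frame, for a
   unit field T.  The following definitions give rho and the twist as smooth functions of
   the first derivatives, so that they may be differentiated in turn. *)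
Definition expansion := 2^-1 * (d11 + d22 + d33 - (p - c) * t1).
(* the components of half the curl of T *)
Let w1 := 2^-1 * (d23 - d32).
Let w2 := 2^-1 * (d31 - d13 + 2 * k * t2 - c * t3).
Let w3 := 2^-1 * (d12 - d21 - p * t2).
Definition twist := 2^-1 * ((d23 - d32) * t1
  + (d31 - d13 + 2 * k * t2 - c * t3) * t2 + (d12 - d21 - p * t2) * t3).

Lemma expansionE : expansion = rho.
Proof.
have e33 : d33 = rho * (1 - t3 ^+ 2) - c * t1 by rewrite -sym33; ring.
have e : d22 = rho * (1 - t2 ^+ 2) + p * t1 by rewrite -sym22; ring.
by rewrite /expansion sym11 e e33; field: t_unit.
Qed.

(** This identity and the next two say w x T = 0. As a matrix, nabla T annihilates T by unit length,
    and so does its symmetric part rho (g - T^b (x) T^b); hence so does the antisymmetric part,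
    which is the cross product with w = (w1, w2, w3). As T is a unit vector, w = <w, T> T. *)
Let c12 : w1 * t2 = w2 * t1.
Proof.
rewrite /w1 /w2.
have e13 : d31 = - 2 * rho * t1 * t3 - d13 + c * t3 by rewrite -sym13; ring.
have e23 : d32 = - 2 * rho * t2 * t3 - d23 + 2 * k * t1 by rewrite -sym23; ring.
have e33 : d33 = rho * (1 - t3 ^+ 2) - c * t1 by rewrite -sym33; ring.
move: unit3; rewrite e13 e23 e33 => u.
apply/eqP; rewrite -subr_eq0 -[X in X == 0]addr0 -{1}u; apply/eqP; by field: t_unit.
Qed.
Let c13 : w1 * t3 = w3 * t1.
Proof.
rewrite /w1 /w3.
have e12 : d21 = - 2 * rho * t1 * t2 - d12 - p * t2 - 2 * k * t3 by rewrite -sym12; ring.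
have e23 : d23 = - 2 * rho * t2 * t3 - d32 + 2 * k * t1 by rewrite -sym23; ring.
have e22 : d22 = rho * (1 - t2 ^+ 2) + p * t1 by rewrite -sym22; ring.
move: unit2; rewrite e12 e23 e22 => u.
apply/eqP; rewrite -subr_eq0 -oppr_eq0 -[X in X == 0]addr0 -{1}u; apply/eqP; by field: t_unit.
Qed.
Let c23 : w2 * t3 = w3 * t2.
Proof.
rewrite /w2 /w3.
have e12 : d12 = - 2 * rho * t1 * t2 - d21 - p * t2 - 2 * k * t3 by rewrite -sym12; ring.
have e13 : d13 = - 2 * rho * t1 * t3 - d31 + c * t3 by rewrite -sym13; ring.
move: unit1; rewrite e12 e13 sym11 => u.
apply/eqP; rewrite -subr_eq0 -[X in X == 0]addr0 -{1}u; apply/eqP; by field: t_unit.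
Qed.

Let twistE : twist = w1 * t1 + w2 * t2 + w3 * t3.
Proof. by rewrite /twist /w1 /w2 /w3; ring. Qed.
Let w1E : w1 = twist * t1.
Proof.
have -> : twist * t1 = w1 * t1 ^+ 2 + (w2 * t1) * t2 + (w3 * t1) * t3 by rewrite twistE; ring.
rewrite -c12 -c13 t_unit; ring.
Qed.
Let w2E : w2 = twist * t2.
Proof.
have -> : twist * t2 = (w1 * t2) * t1 + w2 * t2 ^+ 2 + (w3 * t2) * t3 by rewrite twistE; ring.
rewrite c12 -c23.
have -> : w2 * t1 * t1 = w2 * t1 ^+ 2 by ring.
rewrite t_unit; ring.
Qed.
Let w3E : w3 = twist * t3.
Proof.
have -> : twist * t3 = (w1 * t3) * t1 + (w2 * t3) * t2 + w3 * t3 ^+ 2 by rewrite twistE; ring.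
rewrite c13 c23.
have -> : w3 * t1 * t1 = w3 * t1 ^+ 2 by ring.
rewrite t_unit; ring.
Qed.

Lemma first_order_system :
  [/\ [/\ d11 = grad11 t1 rho, d12 = grad12 k t1 t2 t3 rho twist & d13 = grad13 k t1 t2 t3 rho twist],
      [/\ d21 = grad21 p k t1 t2 t3 rho twist, d22 = grad22 p t1 t2 rho
        & d23 = grad23 k t1 t2 t3 rho twist]
    & [/\ d31 = grad31 k c t1 t2 t3 rho twist, d32 = grad32 k t1 t2 t3 rho twist
        & d33 = grad33 c t1 t3 rho]].
Proof.
rewrite /grad11 /grad12 /grad13 /grad21 /grad22 /grad23 /grad31 /grad32 /grad33.
have e1 : twist * t1 = 2^-1 * (d23 - d32) by rewrite -w1E.
have e2 : twist * t2 = 2^-1 * (d31 - d13 + 2 * k * t2 - c * t3) by rewrite -w2E.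
have e3 : twist * t3 = 2^-1 * (d12 - d21 - p * t2) by rewrite -w3E.
rewrite e1 e2 e3; split; split; rewrite -?sym22 -?sym33; first exact: sym11.
- by apply: (eq_of_half sym12); field.
- by apply: (eq_of_half sym13); field.
- by apply: (eq_of_half sym12); field.
- by rewrite subrK.
- by apply: (eq_of_half sym23); field.
- by apply: (eq_of_half sym13); field.
- by apply: (eq_of_half sym23); field.
- by rewrite addrK.
Qed.

End FirstOrder.

(** * Unit vectors normal to a circular section of the Ricci form *)

Section Algebraic.
Variables (R : realFieldType) (M22 M33 M23 : R).
Hypotheses (M22_gt0 : 0 < M22) (M_det : 0 < M22 * M33 - M23 ^+ 2).
Variables (t1 t2 t3 lam : R).
Hypothesis t_unit : t1 ^+ 2 = 1 - t2 ^+ 2 - t3 ^+ 2.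
Hypothesis r22 : M33 * t1 ^+ 2 = lam * (1 - t2 ^+ 2).
Hypothesis r33 : M22 * t1 ^+ 2 = lam * (1 - t3 ^+ 2).
Hypothesis r23 : M23 * t1 ^+ 2 = lam * (t2 * t3).
Hypothesis r11 : M22 * t3 ^+ 2 - 2 * M23 * (t2 * t3) + M33 * t2 ^+ 2 = lam * (1 - t1 ^+ 2).

(** The hypotheses evaluate a form with block M on e2, e3 and zero on e1 at the vectors T x e_i,
    which span the complement of T. If t1 = 0, then T x e2 and T x e3 are parallel to e1, so [r22]
    and [r33] give lam = 0; [r11] then makes M vanish on the nonzero vector (t3, -t2), against
    positive definiteness. *)
Lemma ricci_neq0 : t1 != 0.
Proof.
apply/eqP => t10; move: t_unit r22 r33 r11; rewrite t10 expr0n /= !mulr0 => tu e2 e3 e1.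
have lam0 : lam = 0 by nra.
move: e1; rewrite lam0 mul0r => e1.
have e4 : (M22 * t3 - M23 * t2) ^+ 2 + (M22 * M33 - M23 ^+ 2) * t2 ^+ 2 = 0.
  have -> : (M22 * t3 - M23 * t2) ^+ 2 + (M22 * M33 - M23 ^+ 2) * t2 ^+ 2 =
    M22 * (M22 * t3 ^+ 2 - 2 * M23 * (t2 * t3) + M33 * t2 ^+ 2) by ring.
  by rewrite e1 mulr0.
have D0 := mulr_ge0 (ltW M_det) (sqr_ge0 t2).
move/eqP: e4; rewrite paddr_eq0 ?sqr_ge0 //.
rewrite [X in _ && X]mulf_eq0 (gt_eqF M_det) /= !sqrf_eq0 => /andP[/eqP h1 /eqP h2].
move: h1; rewrite h2 mulr0 subr0 => /eqP; rewrite mulf_eq0 (gt_eqF M22_gt0) /= => /eqP h3.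
move: tu; rewrite h2 h3 expr0n /=; lra.
Qed.

Let tau := M22 + M33.
Let t10 : t1 ^+ 2 != 0. Proof. by rewrite sqrf_eq0 ricci_neq0. Qed.
(** The sum of [r22] and [r33]. It expresses lam through t1^2 and so eliminates it from the other
    relations. *)
Let tauE : tau * t1 ^+ 2 = lam * (1 + t1 ^+ 2).
Proof. rewrite /tau mulrDl r22 r33; ring: t_unit. Qed.

Lemma ricci_t2 : tau * (1 - t2 ^+ 2) = M33 * (1 + t1 ^+ 2).
Proof.
apply: (mulIf t10).
have -> : M33 * (1 + t1 ^+ 2) * t1 ^+ 2 = (M33 * t1 ^+ 2) * (1 + t1 ^+ 2) by ring.
have -> : tau * (1 - t2 ^+ 2) * t1 ^+ 2 = (tau * t1 ^+ 2) * (1 - t2 ^+ 2) by ring.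
rewrite r22 tauE; ring.
Qed.
Lemma ricci_t3 : tau * (1 - t3 ^+ 2) = M22 * (1 + t1 ^+ 2).
Proof.
apply: (mulIf t10).
have -> : M22 * (1 + t1 ^+ 2) * t1 ^+ 2 = (M22 * t1 ^+ 2) * (1 + t1 ^+ 2) by ring.
have -> : tau * (1 - t3 ^+ 2) * t1 ^+ 2 = (tau * t1 ^+ 2) * (1 - t3 ^+ 2) by ring.
rewrite r33 tauE; ring.
Qed.
Lemma ricci_t23 : tau * (t2 * t3) = M23 * (1 + t1 ^+ 2).
Proof.
apply: (mulIf t10).
have -> : M23 * (1 + t1 ^+ 2) * t1 ^+ 2 = (M23 * t1 ^+ 2) * (1 + t1 ^+ 2) by ring.
have -> : tau * (t2 * t3) * t1 ^+ 2 = (tau * t1 ^+ 2) * (t2 * t3) by ring.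
rewrite r23 tauE; ring.
Qed.
(** Taking [r22] times [r33] minus the square of [r23] gives det(M) t1^4 = lam^2 t1^2, since (1 -
    t2^2) (1 - t3^2) - t2^2 t3^2 = t1^2. So t1^2 is a root of a quadratic polynomial with constant
    coefficients. *)
Lemma ricci_t1 : (M22 * M33 - M23 ^+ 2) * (1 + t1 ^+ 2) ^+ 2 = tau ^+ 2 * t1 ^+ 2.
Proof.
have e : (M22 * M33 - M23 ^+ 2) * t1 ^+ 2 = lam ^+ 2.
  apply: (mulIf t10).
  have -> : (M22 * M33 - M23 ^+ 2) * t1 ^+ 2 * t1 ^+ 2 =
    (M22 * t1 ^+ 2) * (M33 * t1 ^+ 2) - (M23 * t1 ^+ 2) ^+ 2 by ring.
  rewrite r22 r33 r23 t_unit; ring.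
apply: (mulIf t10).
have -> : (M22 * M33 - M23 ^+ 2) * (1 + t1 ^+ 2) ^+ 2 * t1 ^+ 2 =
  ((M22 * M33 - M23 ^+ 2) * t1 ^+ 2) * (1 + t1 ^+ 2) ^+ 2 by ring.
have -> : tau ^+ 2 * t1 ^+ 2 * t1 ^+ 2 = (tau * t1 ^+ 2) ^+ 2 by ring.
rewrite e tauE; ring.
Qed.
End Algebraic.

Section Rigidity.
Variables (R : realFieldType) (M22 M33 M23 : R).
Hypotheses (M22_gt0 : 0 < M22) (M_det : 0 < M22 * M33 - M23 ^+ 2).
Let tau := M22 + M33.
Let tau_gt0 : 0 < tau.
Proof.
rewrite addr_gt0 // -(pmulr_rgt0 _ M22_gt0) (lt_le_trans M_det) // gerBl.
exact: sqr_ge0.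
Qed.
Variables (t1 t2 t3 x1 x2 x3 : R).
Hypothesis t_unit : t1 ^+ 2 = 1 - t2 ^+ 2 - t3 ^+ 2.
Hypothesis E1 : (M22 * M33 - M23 ^+ 2) * (1 + t1 ^+ 2) ^+ 2 = tau ^+ 2 * t1 ^+ 2.
Hypothesis dE1 : (M22 * M33 - M23 ^+ 2) * (2 * (1 + t1 ^+ 2) * x1) = tau ^+ 2 * x1.
Hypothesis dE2 : - tau * (2 * t2 * x2) = M33 * x1.
Hypothesis dE3 : - tau * (2 * t3 * x3) = M22 * x1.
Hypothesis dE23 : tau * (t2 * x3 + t3 * x2) = M23 * x1.

(** Here x1 is the derivative of t1^2, while x2 and x3 are those of t2 and t3. If x1 were nonzero,
    t1^2 would be a double root of the quadratic [E1], hence equal to 1, and t2 = t3 = 0. With x1 =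
    0 the derivatives of t2^2, t3^2 and t2 t3 vanish, and one division by the nonzero component
    settles both. *)
Lemma rigidity : t2 != 0 \/ t3 != 0 -> x2 = 0 /\ x3 = 0.
Proof.
move=> t23; have s0 : 0 < t2 ^+ 2 + t3 ^+ 2.
  case: t23 => h; [rewrite ltr_wpDr ?sqr_ge0 //|rewrite ltr_wpDl ?sqr_ge0 //];
  by rewrite lt0r sqrf_eq0 h sqr_ge0.
have x10 : x1 = 0.
  apply/eqP; apply/negPn/negP => x1n.
  have e : (M22 * M33 - M23 ^+ 2) * (2 * (1 + t1 ^+ 2)) = tau ^+ 2.
    by apply: (mulIf x1n); rewrite -dE1; ring.
  have e2 : (M22 * M33 - M23 ^+ 2) * (1 + t1 ^+ 2) * (1 - t1 ^+ 2) = 0.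
    have -> : (M22 * M33 - M23 ^+ 2) * (1 + t1 ^+ 2) * (1 - t1 ^+ 2) =
      (M22 * M33 - M23 ^+ 2) * (1 + t1 ^+ 2) ^+ 2
      - (M22 * M33 - M23 ^+ 2) * (2 * (1 + t1 ^+ 2)) * t1 ^+ 2 by ring.
    by rewrite E1 e subrr.
  move/eqP: e2; rewrite !mulf_eq0 (gt_eqF M_det) /= => /orP[/eqP h|/eqP h].
    by have := sqr_ge0 t1; lra.
  by move: h; rewrite t_unit; lra.
have tau0 := lt0r_neq0 tau_gt0.
have h2 : t2 * x2 = 0.
  apply: (mulfI tau0); apply: (eq_of_half (x := M33 * x1) (y := - tau * (2 * t2 * x2))).
    by rewrite dE2.
  by rewrite x10; field.
have h3 : t3 * x3 = 0.
  apply: (mulfI tau0); apply: (eq_of_half (x := M22 * x1) (y := - tau * (2 * t3 * x3))).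
    by rewrite dE3.
  by rewrite x10; field.
have h : t2 * x3 + t3 * x2 = 0 by apply: (mulfI tau0); rewrite dE23 x10 !mulr0.
case: t23 => tn.
  have x20 : x2 = 0 by apply: (mulfI tn); rewrite h2 mulr0.
  by split=> //; apply: (mulfI tn); move: h; rewrite x20 !mulr0 addr0.
have x30 : x3 = 0 by apply: (mulfI tn); rewrite h3 mulr0.
by split=> //; apply: (mulfI tn); move: h; rewrite x30 !mulr0 add0r.
Qed.
End Rigidity.

(** For a scalar block M the two circular sections coincide: the relations become t2^2 = t3^2 and t2
    t3 = 0, which leaves only T = e1 up to sign. *)
Lemma rigidity_degenerate (R : realFieldType) (M22 M33 M23 t2 t3 : R) : 0 < M22 + M33 ->
  M22 = M33 -> M23 = 0 ->
  (M22 + M33) * (1 - t2 ^+ 2) = M33 * (1 + (1 - t2 ^+ 2 - t3 ^+ 2)) ->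
  (M22 + M33) * (t2 * t3) = M23 * (1 + (1 - t2 ^+ 2 - t3 ^+ 2)) -> t2 = 0 /\ t3 = 0.
Proof.
move=> tau0 e -> e2 /eqP; rewrite mul0r !mulf_eq0 (gt_eqF tau0) /= => t23.
have h : M33 * (t2 ^+ 2 - t3 ^+ 2) = 0 by move: e2; rewrite e; lra.
have M0 : M33 != 0 by apply/eqP => M30; move: tau0; rewrite e M30 addr0 ltxx.
move/eqP: h; rewrite mulf_eq0 (negbTE M0) /= subr_eq0 => h.
case/orP: t23 => /eqP t0; move: h; rewrite t0 expr0n /= ?sqrf_eq0 1?eq_sym ?sqrf_eq0;
  by move=> /eqP.
Qed.

(** * Left-invariant fields on the group *)

Section LeftInvariant.
Context {R : realType} (alpha : R).
Implicit Types (a b u v p q : 'rV[R]_3) (f h : 'rV[R]_3 -> R).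

Definition rv3 (x y z : R) : 'rV[R]_3 := \row_k nth 0 [:: x; y; z] k.

Lemma rv3E0 x y z : rv3 x y z 0 0 = x. Proof. by rewrite mxE. Qed.
Lemma rv3E1 x y z : rv3 x y z 0 1 = y. Proof. by rewrite mxE. Qed.
Lemma rv3E2 x y z : rv3 x y z 0 2 = z. Proof. by rewrite mxE. Qed.
Definition rv3E := (rv3E0, rv3E1, rv3E2).

Lemma rv3P u v : u 0 0 = v 0 0 -> u 0 1 = v 0 1 -> u 0 2 = v 0 2 -> u = v.
Proof.
move=> e0 e1 e2; apply/rowP => -[[|[|[|//]]] i].
- by rewrite (_ : Ordinal i = 0) //; apply/val_inj.
- by rewrite (_ : Ordinal i = 1) //; apply/val_inj.
- by rewrite (_ : Ordinal i = 2) //; apply/val_inj.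
Qed.

Lemma sum3 (V : nmodType) (F : 'I_3 -> V) : \sum_i F i = F 0 + F 1 + F 2.
Proof.
rewrite !big_ord_recl big_ord0 addr0 addrA.
by congr (F _ + F _ + F _); apply/val_inj.
Qed.

(* the left-invariant vector field with value a at the unit element *)
Definition lfield a q : 'rV[R]_3 :=
  rv3 (a 0 0) (a 0 1 * expR (alpha * q 0 0)) (a 0 2 * expR (- q 0 0)).

Lemma lfield0 a q : lfield a q 0 0 = a 0 0. Proof. by rewrite rv3E. Qed.

Lemma lfieldD a b q : lfield (a + b) q = lfield a q + lfield b q.
Proof. by apply: rv3P; rewrite !(rv3E, mxE) /= ?mulrDl. Qed.

Lemma lfieldZ c a q : lfield (c *: a) q = c *: lfield a q.
Proof. by apply: rv3P; rewrite !(rv3E, mxE) /= ?mulrA. Qed.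

Lemma lfield_surj u q : exists a, u = lfield a q.
Proof.
exists (rv3 (u 0 0) (u 0 1 / expR (alpha * q 0 0)) (u 0 2 / expR (- q 0 0))).
by apply: rv3P; rewrite !rv3E ?divfK // gt_eqF ?expR_gt0.
Qed.

(** Left translation is affine in these coordinates, so its differential at the unit element 0 is u
    |-> [lfield u p]. *)
Lemma left_transE p : Defs.left_trans alpha (Gparam alpha p) = fun q => p + lfield q p.
Proof.
apply/funext => q; apply: rv3P; rewrite /Defs.left_trans !mxE /= ?sum3 !mxE /=.
- by rewrite mul0r mulr0 add0r addr0 -expRD expRK opprD !opprK.
- by rewrite mulr1 mul0r addr0 addrC mulrC.
- by rewrite mulr1 mul0r add0r addrC mulrC.
Qed.

Lemma diff_left_trans p u : 'd (fun q => p + lfield q p) 0 u = lfield u p.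
Proof.
pose r (i : 'I_3) := lfield (delta_mx 0 i) p.
have fE : (fun q => p + lfield q p) =
    (cst p : 'rV[R]_3 -> 'rV[R]_3) + \sum_i (fun q => q 0 i *: r i).
  apply/funext => q; rewrite fctE fct_sumE sum3; congr (_ + _).
  by apply: rv3P; rewrite !(rv3E, mxE) /=; ring.
have df : differentiable (fun q => p + lfield q p) 0.
  rewrite fE; apply: differentiableD; first exact: differentiable_cst.
  apply: differentiable_sum => i; apply: differentiableZl.
  exact: differentiable_coord.
rewrite -deriveE // derive_mx; last exact: diff_derivable.
have dcoord (k : 'I_3) (c d : R) : 'D_u (fun q : 'rV[R]_3 => c + q 0 k * d) 0 = u 0 k * d.
  have e : (fun q : 'rV[R]_3 => c + q 0 k * d) =
    cst c + d *: (fun q : 'rV[R]_3 => q 0 k).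
    by apply/funext => q; rewrite !fctE /GRing.scale /= mulrC.
  have dk : derivable (fun q : 'rV[R]_3 => q 0 k) 0 u.
    by apply: diff_derivable; apply: differentiable_coord.
  rewrite e deriveD; [|exact: derivable_cst|exact: derivableZ].
  by rewrite derive_cst deriveZ // derive_coord add0r /GRing.scale /= mulrC.
apply: rv3P; rewrite rv3E mxE.
- rewrite -[RHS]mulr1 -(dcoord 0 (p 0 0) 1); congr ('D_u _ 0).
  by apply/funext => q; rewrite mxE rv3E mulr1.
- rewrite -(dcoord 1 (p 0 1)); congr ('D_u _ 0).
  by apply/funext => q; rewrite mxE rv3E.
- rewrite -(dcoord 2 (p 0 2)); congr ('D_u _ 0).
  by apply/funext => q; rewrite mxE rv3E.
Qed.

Lemma inner_lfield g p u v : left_invariant alpha g ->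
  inner g p (lfield u p) (lfield v p) = inner g 0 u v.
Proof.
move=> ginv; have := ginv _ (Galpha_Gparam alpha p) 0 u v.
rewrite left_transE !diff_left_trans => <-; congr (inner g _ _ _).
by apply: rv3P; rewrite !(rv3E, mxE) ?mul0r ?addr0.
Qed.

Definition lderive a f q : R := 'D_(lfield a q) f q.

(** The Lie algebra bracket: the x-direction acts on the abelian ideal of the y- and z-directions as
    diag(alpha, -1). *)
Definition bracket a b : 'rV[R]_3 :=
  rv3 0 (alpha * (a 0 0 * b 0 1 - b 0 0 * a 0 1)) (b 0 0 * a 0 2 - a 0 0 * b 0 2).

Lemma lderiveE U a f q : smooth_fun U f -> U q -> lderive a f q =
  a 0 0 * pd 0 f q + a 0 1 * (expR (alpha * q 0 0) * pd 1 f q)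
  + a 0 2 * (expR (- q 0 0) * pd 2 f q).
Proof.
move=> sf Uq; rewrite /lderive derive_pd ?sum3 ?rv3E ?mulrA //.
exact: smooth_differentiable sf Uq.
Qed.

Lemma smooth_exp_coord U (c : R) : open U -> smooth_fun U (fun q : 'rV[R]_3 => expR (c * q 0 0)).
Proof.
move=> oU; apply: (@smooth_expR _ _ _ (fun q : 'rV[R]_3 => c * q 0 0)) => //.
by apply: smoothM => //; [exact: smooth_cst|exact: smooth_coord].
Qed.

Lemma smooth_exp_coordN U : open U -> smooth_fun U (fun q : 'rV[R]_3 => expR (- q 0 0)).
Proof.
move=> oU; apply: (@smooth_expR _ _ _ (fun q : 'rV[R]_3 => - q 0 0)) => //.
by apply: smoothN => //; exact: smooth_coord.
Qed.

Lemma smooth_lderive U a f : open U -> smooth_fun U f -> smooth_fun U (lderive a f).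
Proof.
move=> oU sf.
apply: (eq_on_smooth oU (fun q Uq => esym (lderiveE a sf Uq))).
apply: (smoothD oU); [apply: (smoothD oU)|].
- by apply: (smoothM oU); [exact: smooth_cst|exact: smooth_pd].
- apply: (smoothM oU); first exact: smooth_cst.
  by apply: (smoothM oU); [exact: smooth_exp_coord|exact: smooth_pd].
- apply: (smoothM oU); first exact: smooth_cst.
  by apply: (smoothM oU); [exact: smooth_exp_coordN|exact: smooth_pd].
Qed.

Lemma smooth_lfield U a : open U -> smooth_mx U (lfield a).
Proof.
move=> oU i j; rewrite ord1; case: j => -[|[|[|//]]] hj.
- rewrite (_ : (fun p => _) = (fun=> a 0 0)); first exact: smooth_cst.
  by apply/funext => q; rewrite mxE.
- rewrite (_ : (fun p => _) = (fun q => a 0 1 * expR (alpha * q 0 0))).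
    by apply: smoothM => //; [exact: smooth_cst|exact: smooth_exp_coord].
  by apply/funext => q; rewrite mxE.
- rewrite (_ : (fun p => _) = (fun q => a 0 2 * expR (- q 0 0))).
    by apply: smoothM => //; [exact: smooth_cst|exact: smooth_exp_coordN].
  by apply/funext => q; rewrite mxE.
Qed.

Lemma is_derive_exp_coord c q v :
  is_derive q v (fun q : 'rV[R]_3 => expR (c * q 0 0)) (c * v 0 0 * expR (c * q 0 0)).
Proof.
have df : differentiable (fun q : 'rV[R]_3 => c * q 0 0) q.
  by apply: differentiableM => //; exact: differentiable_coord.
have [dc dE] := derive_comp_scalar v df (is_derive_expR _).
apply: DeriveDef; first exact: diff_derivable.
rewrite [LHS]dE mulrC; congr (_ * _).
have dk : derivable (fun q : 'rV[R]_3 => q 0 0) q v.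
  by apply: diff_derivable; apply: differentiable_coord.
by rewrite (_ : (fun q => _) = c *: (fun q : 'rV[R]_3 => q 0 0)) // deriveZ // derive_coord.
Qed.

Lemma is_derive_exp_coordN q v :
  is_derive q v (fun q : 'rV[R]_3 => expR (- q 0 0)) (- v 0 0 * expR (- q 0 0)).
Proof.
have := is_derive_exp_coord (-1) q v; rewrite !mulN1r.
by rewrite (_ : (fun q : 'rV[R]_3 => expR (-1 * q 0 0)) = (fun q : 'rV[R]_3 => expR (- q 0 0))) //;
  apply/funext => z; rewrite mulN1r.
Qed.

Lemma lderive_comm U a b f q : open U -> smooth_fun U f -> U q ->
  lderive a (lderive b f) q - lderive b (lderive a f) q = lderive (bracket a b) f q.
Proof.
move=> oU sf Uq.
(* The partial derivatives are abstracted to variables: with Schwarz's theorem recorded as [xC], the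
   claim becomes a polynomial identity. *)
have [x xE] : exists x : 'I_3 -> 'I_3 -> R, forall i j, x i j = pd i (pd j f) q.
  by exists (fun i j => pd i (pd j f) q).
have [y yE] : exists y : 'I_3 -> R, forall i, y i = pd i f q.
  by exists (fun i => pd i f q).
have xC i j : x i j = x j i by rewrite !xE; exact: (pd_comm i j oU sf Uq).
pose z u i := u 0 0 * x 0 i + u 0 1 * (expR (alpha * q 0 0) * x 1 i)
  + u 0 2 * (expR (- q 0 0) * x 2 i).
have dpd u i : is_derive q (lfield u q) (pd i f) (z u i).
  apply: DeriveDef.
    by apply: diff_derivable; exact: smooth_differentiable (smooth_pd i sf) Uq.
  by rewrite /z !xE; exact: (lderiveE u (smooth_pd i sf) Uq).
have key u v : lderive u (lderive v f) q =
   v 0 0 * z u 0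
   + v 0 1 * (expR (alpha * q 0 0) * z u 1
        + alpha * u 0 0 * expR (alpha * q 0 0) * y 1)
   + v 0 2 * (expR (- q 0 0) * z u 2 - u 0 0 * expR (- q 0 0) * y 2).
  rewrite {1}/lderive (eq_on_derive _ oU Uq (fun z Uz => lderiveE v sf Uz)).
  have e0 := dpd u 0; have e1 := dpd u 1; have e2 := dpd u 2.
  have e3 := is_derive_exp_coord alpha q (lfield u q).
  have e4 := is_derive_exp_coordN q (lfield u q).
  apply: derive_val; apply: is_derive_eq.
  rewrite lfield0 /GRing.scale /= -(yE 1) -(yE 2).
  by move: (z u) => zu; ring.
rewrite !key (lderiveE _ sf Uq) -(yE 0) -(yE 1) -(yE 2) /z (xC 1 0) (xC 2 0) (xC 2 1).
rewrite /bracket !rv3E; ring.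
Qed.

End LeftInvariant.

(** * Left-invariant orthonormal frames and L_T g in such frames *)

Lemma exists_unit_scaling (R : realType) n (g : 'rV[R]_n -> 'M[R]_n) (p u : 'rV[R]_n) :
  (forall u, u != 0 -> 0 < inner g p u u) -> u != 0 ->
  exists2 c : R, 0 < c & inner g p (c *: u) (c *: u) = 1.
Proof.
move=> gp /gp uu; exists (Num.sqrt (inner g p u u))^-1.
  by rewrite invr_gt0 sqrtr_gt0.
set c := _^-1; rewrite /inner linearZ /= -!scalemxAl -scalemxAr scalerA mxE.
rewrite -expr2 exprVn sqr_sqrtr ?ltW // mulVf // gt_eqF //.
Qed.

(** Gram-Schmidt in the order y, z, x. Then f2 and f3 span the abelian ideal, and f2 lies on an
    eigenline of the action of x, which gives the brackets their triangular shape. *)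
Lemma exists_orthonormal_frame (R : realType) (g : 'rV[R]_3 -> 'M[R]_3) (p : 'rV[R]_3) :
  (g p)^T = g p -> (forall u, u != 0 -> 0 < inner g p u u) ->
  exists c i j r s m : R, [/\ 0 < c, 0 < r, 0 < m &
    let f1 := rv3 c i j in let f2 := rv3 0 r 0 in let f3 := rv3 0 s m in
    [/\ inner g p f1 f1 = 1, inner g p f2 f2 = 1 & inner g p f3 f3 = 1] /\
    [/\ inner g p f1 f2 = 0, inner g p f1 f3 = 0 & inner g p f2 f3 = 0]].
Proof.
move=> gs gp; have gC := innerC gs.
have nz (u : 'rV[R]_3) k : u 0 k != 0 -> u != 0.
  by apply: contraNneq => ->; rewrite mxE.
have [r r0 r1] : exists2 r : R, 0 < r & inner g p (r *: rv3 0 1 0) (r *: rv3 0 1 0) = 1.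
  by apply: exists_unit_scaling => //; apply: (nz _ 1); rewrite rv3E oner_neq0.
move f2E : (r *: rv3 0 1 0) r1 => f2 r1.
move ZE : (rv3 0 0 1 - inner g p (rv3 0 0 1) f2 *: f2) => Z.
have ZY : inner g p Z f2 = 0 by rewrite -ZE innerDl innerNl innerZl r1 mulr1 subrr.
have [m m0 m1] : exists2 m : R, 0 < m & inner g p (m *: Z) (m *: Z) = 1.
  apply: exists_unit_scaling => //; apply: (nz _ 2).
  by rewrite -ZE -f2E !(mxE, rv3E) /= !mulr0 subr0 oner_neq0.
move f3E : (m *: Z) m1 => f3 m1.
have f32 : inner g p f3 f2 = 0 by rewrite -f3E innerZl ZY mulr0.
move XE : (rv3 1 0 0 - inner g p (rv3 1 0 0) f2 *: f2
  - inner g p (rv3 1 0 0) f3 *: f3) => X.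
have [c c0 c1] : exists2 c : R, 0 < c & inner g p (c *: X) (c *: X) = 1.
  apply: exists_unit_scaling => //; apply: (nz _ 0).
  by rewrite -XE -f3E -ZE -f2E !(mxE, rv3E) /= !(mulr0, subr0) oner_neq0.
move f1E : (c *: X) c1 => f1 c1.
have f12 : inner g p f1 f2 = 0.
  by rewrite -f1E -XE innerZl !innerDl !innerNl !innerZl r1 f32 mulr1 mulr0 subr0 subrr mulr0.
have f13 : inner g p f1 f3 = 0.
  by rewrite -f1E -XE innerZl !innerDl !innerNl !innerZl m1 (gC f2) f32 mulr1 mulr0 subr0 subrr mulr0.
exists c, (f1 0 1), (f1 0 2), r, (f3 0 1), m; split=> //.
have e2 : rv3 0 r 0 = f2 by rewrite -f2E; apply: rv3P; rewrite !(mxE, rv3E) /=; ring.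
have e3 : rv3 0 (f3 0 1) m = f3.
  by apply: rv3P; rewrite !rv3E // -f3E -ZE -f2E !(mxE, rv3E) /=; ring.
have e1 : rv3 c (f1 0 1) (f1 0 2) = f1.
  by apply: rv3P; rewrite !rv3E // -f1E -XE -e3 -f2E !(mxE, rv3E) /=; ring.
by rewrite /= e1 e2 e3; do 2!split=> //; rewrite gC.
Qed.

Section LieInFrame.
Context {R : realType} (alpha : R) (g : 'rV[R]_3 -> 'M[R]_3).
Hypotheses (g_metric : riemannian_metric g setT) (g_inv : left_invariant alpha g).
Implicit Types (a u v q : 'rV[R]_3).
Local Notation lf := (lfield alpha).

Lemma dmx_lfield a u q :
  dmx (lf a) q (lf u q) = lf (rv3 0 (alpha * u 0 0 * a 0 1) (- u 0 0 * a 0 2)) q.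
Proof.
have [e1 d1] := is_derive_exp_coord alpha q (lf u q).
have [e2 d2] := is_derive_exp_coordN q (lf u q).
rewrite lfield0 in d1 d2.
apply: rv3P; rewrite /lfield !rv3E mxE.
- rewrite (_ : (fun x => _) = cst (a 0 0)); first exact: derive_cst.
  by apply/funext => x; rewrite mxE.
- rewrite (_ : (fun x => _) = a 0 1 *: (fun x : 'rV[R]_3 => expR (alpha * x 0 0))).
    by rewrite (deriveZ _ e1) d1 /GRing.scale /=; ring.
  by apply/funext => x; rewrite mxE.
- rewrite (_ : (fun x => _) = a 0 2 *: (fun x : 'rV[R]_3 => expR (- x 0 0))).
    by rewrite (deriveZ _ e2) d2 /GRing.scale /=; ring.
  by apply/funext => x; rewrite mxE.
Qed.

Lemma dmx_lfieldB a u q :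
  dmx (lf a) q (lf u q) - dmx (lf u) q (lf a q) = lf (bracket alpha u a) q.
Proof. by rewrite !dmx_lfield; apply: rv3P; rewrite !(mxE, rv3E) /=; ring. Qed.

Lemma dmetric_lfield q a u v : dmetric g q (lf a q) (lf u q) (lf v q) =
  - inner g q (dmx (lf u) q (lf a q)) (lf v q) - inner g q (lf u q) (dmx (lf v) q (lf a q)).
Proof.
have dl b : diff_mx (lf b) q.
  by apply: (@smooth_diff_mx _ _ _ _ setT) => //; apply: smooth_lfield; apply: openT.
have := derive_inner (I : setT q) g_metric (lf a q) (dl u) (dl v).
have -> : (fun q => inner g q (lf u q) (lf v q)) = cst (inner g 0 u v).
  by apply/funext => x; rewrite inner_lfield.
rewrite derive_cst; lra.
Qed.

(** T is compared with the left-invariant field [lf a] that agrees with it at [q]. Inner products of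
    left-invariant fields are constant, so the derivatives of <T, lf v> measure how the first
    derivatives of the two fields differ; the Lie derivative of g along [lf a] supplies the bracket
    terms. *)
Lemma lie_metric_lfield (T : 'rV[R]_3 -> 'rV[R]_3) q a u v :
  diff_mx T q -> T q = lf a q ->
  lie_metric g T q (lf u q) (lf v q) =
    lderive alpha u (fun x => inner g x (T x) (lf v x)) q
    + lderive alpha v (fun x => inner g x (T x) (lf u x)) q
    + inner g 0 (bracket alpha u a) v + inner g 0 (bracket alpha v a) u.
Proof.
move=> dT Ta.
have gs : (g q)^T = g q by case: g_metric => _ + _; apply.
have dl b : diff_mx (lf b) q.
  by apply: (@smooth_diff_mx _ _ _ _ setT) => //; apply: smooth_lfield; apply: openT.
have key x y : lderive alpha x (fun z => inner g z (T z) (lf y z)) q =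
    inner g q (dmx T q (lf x q)) (lf y q) - inner g q (dmx (lf a) q (lf x q)) (lf y q).
  rewrite /lderive (derive_inner (I : setT q) g_metric (lf x q) dT (dl y)) Ta.
  rewrite dmetric_lfield; ring.
rewrite !key -!(inner_lfield q _ _ g_inv) -!dmx_lfieldB !innerDl !innerNl.
rewrite /lie_metric Ta dmetric_lfield (innerC gs (lf u q) (dmx (lf v) q _)).
rewrite (innerC gs (lf u q) (dmx T q _)).
ring.
Qed.

End LieInFrame.

(** * Differentiating the first-order system and the algebraic relations *)

Section DerivativeOfSystem.
Context {R : realType} {V : normedModType R} (q v : V).
Implicit Types f h : V -> R.

Let idD f h a b : is_derive q v f a -> is_derive q v h b ->
  is_derive q v (fun y => f y + h y) (a + b).
Proof. by move=> df dh; apply: is_deriveD. Qed.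

Let idN f a : is_derive q v f a -> is_derive q v (fun y => - f y) (- a).
Proof. by move=> df; apply: is_deriveN. Qed.

Let idB f h a b : is_derive q v f a -> is_derive q v h b ->
  is_derive q v (fun y => f y - h y) (a - b).
Proof. by move=> df dh; apply: is_deriveB. Qed.

Let idM f h a b : is_derive q v f a -> is_derive q v h b ->
  is_derive q v (fun y => f y * h y) (f q * b + h q * a).
Proof. by move=> df dh; apply: is_deriveM. Qed.

Let idZ (k : R) f a : is_derive q v f a -> is_derive q v (fun y => k * f y) (k * a).
Proof. by move=> df; apply: is_deriveZ. Qed.

Lemma is_derive_sqr f a : is_derive q v f a -> is_derive q v (fun y => f y ^+ 2) (2 * f q * a).
Proof.
move=> df; have := idM df df.
by rewrite (_ : f q * a + f q * a = 2 * f q * a) //; ring.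
Qed.

Let id1D f a : is_derive q v f a -> is_derive q v (fun y => 1 + f y) a.
Proof.
by move=> df; have := idD (is_derive_cst (1 : R) q v) df; rewrite add0r.
Qed.

Let id1X f a : is_derive q v f a -> is_derive q v (fun y => 1 - f y ^+ 2) (- (2 * f q * a)).
Proof.
by move=> df; have := idB (is_derive_cst (1 : R) q v) (is_derive_sqr df); rewrite sub0r.
Qed.

Variables (p k c : R) (t1 t2 t3 rho w : V -> R) (x1 x2 x3 r o : R).
Hypotheses (h1 : is_derive q v t1 x1) (h2 : is_derive q v t2 x2)
  (h3 : is_derive q v t3 x3) (hr : is_derive q v rho r) (hw : is_derive q v w o).

Lemma derive_grad11 : 'D_v (fun y => grad11 (t1 y) (rho y)) q =
  dgrad11 (t1 q) (rho q) r o x1 x2 x3.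
Proof. have [_ E] := idM hr (id1X h1); rewrite [LHS]E /dgrad11; ring. Qed.

Lemma derive_grad12 : 'D_v (fun y => grad12 k (t1 y) (t2 y) (t3 y) (rho y) (w y)) q =
  dgrad12 k (t1 q) (t2 q) (t3 q) (rho q) (w q) r o x1 x2 x3.
Proof. have [_ E] := idB (idD (idM (idM (idN hr) h1) h2) (idM hw h3)) (idZ k h3); rewrite [LHS]E /dgrad12; ring. Qed.

Lemma derive_grad13 : 'D_v (fun y => grad13 k (t1 y) (t2 y) (t3 y) (rho y) (w y)) q =
  dgrad13 k (t1 q) (t2 q) (t3 q) (rho q) (w q) r o x1 x2 x3.
Proof. have [_ E] := idD (idB (idM (idM (idN hr) h1) h3) (idM hw h2)) (idZ k h2); rewrite [LHS]E /dgrad13; ring. Qed.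

Lemma derive_grad21 : 'D_v (fun y => grad21 p k (t1 y) (t2 y) (t3 y) (rho y) (w y)) q =
  dgrad21 p k (t1 q) (t2 q) (t3 q) (rho q) (w q) r o x1 x2 x3.
Proof. have [_ E] := idB (idB (idB (idM (idM (idN hr) h1) h2) (idM hw h3)) (idZ p h2)) (idZ k h3); rewrite [LHS]E /dgrad21; ring. Qed.

Lemma derive_grad22 : 'D_v (fun y => grad22 p (t1 y) (t2 y) (rho y)) q =
  dgrad22 p (t2 q) (rho q) r o x1 x2 x3.
Proof. have [_ E] := idD (idM hr (id1X h2)) (idZ p h1); rewrite [LHS]E /dgrad22; ring. Qed.

Lemma derive_grad23 : 'D_v (fun y => grad23 k (t1 y) (t2 y) (t3 y) (rho y) (w y)) q =
  dgrad23 k (t1 q) (t2 q) (t3 q) (rho q) (w q) r o x1 x2 x3.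
Proof. have [_ E] := idD (idD (idM (idM (idN hr) h2) h3) (idM hw h1)) (idZ k h1); rewrite [LHS]E /dgrad23; ring. Qed.

Lemma derive_grad31 : 'D_v (fun y => grad31 k c (t1 y) (t2 y) (t3 y) (rho y) (w y)) q =
  dgrad31 k c (t1 q) (t2 q) (t3 q) (rho q) (w q) r o x1 x2 x3.
Proof. have [_ E] := idD (idB (idD (idM (idM (idN hr) h1) h3) (idM hw h2)) (idZ k h2)) (idZ c h3); rewrite [LHS]E /dgrad31; ring. Qed.

Lemma derive_grad32 : 'D_v (fun y => grad32 k (t1 y) (t2 y) (t3 y) (rho y) (w y)) q =
  dgrad32 k (t1 q) (t2 q) (t3 q) (rho q) (w q) r o x1 x2 x3.
Proof. have [_ E] := idD (idB (idM (idM (idN hr) h2) h3) (idM hw h1)) (idZ k h1); rewrite [LHS]E /dgrad32; ring. Qed.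

Lemma derive_grad33 : 'D_v (fun y => grad33 c (t1 y) (t3 y) (rho y)) q =
  dgrad33 c (t3 q) (rho q) r o x1 x2 x3.
Proof. have [_ E] := idB (idM hr (id1X h3)) (idZ c h1); rewrite [LHS]E /dgrad33; ring. Qed.

Lemma derive_sqr : 'D_v (fun y => t1 y ^+ 2) q = 2 * t1 q * x1.
Proof. have [_ E] := is_derive_sqr h1; rewrite [LHS]E; ring. Qed.

Lemma derive_scale : 'D_v (fun y => p * t1 y) q = p * x1.
Proof. have [_ E] := idZ p h1; rewrite [LHS]E; ring. Qed.

Lemma derive_1D : 'D_v (fun y => p * (1 + t1 y)) q = p * x1.
Proof. have [_ E] := idZ p (id1D h1); rewrite [LHS]E; ring. Qed.

Lemma derive_1Dsqr : 'D_v (fun y => p * (1 + t1 y) ^+ 2) q = p * (2 * (1 + t1 q) * x1).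
Proof. have [_ E] := idZ p (is_derive_sqr (id1D h1)); rewrite [LHS]E; ring. Qed.

Lemma derive_1Bsqr : 'D_v (fun y => p * (1 - t1 y ^+ 2)) q = - p * (2 * t1 q * x1).
Proof. have [_ E] := idZ p (id1X h1); rewrite [LHS]E; ring. Qed.

Lemma derive_mul : 'D_v (fun y => p * (t1 y * t2 y)) q = p * (t1 q * x2 + t2 q * x1).
Proof. have [_ E] := idZ p (idM h1 h2); rewrite [LHS]E; ring. Qed.

Lemma derive_1Bsqr2 : 'D_v (fun y => 1 - t1 y ^+ 2 - t2 y ^+ 2) q =
  - (2 * t1 q * x1) - 2 * t2 q * x2.
Proof. by have [_ E] := idB (id1X h1) (is_derive_sqr h2); rewrite [LHS]E. Qed.

End DerivativeOfSystem.

(** * Integrability along a shear-free geodesic field *)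

Section Bracket.
Context {R : realType} (alpha : R).
Implicit Types (u v : 'rV[R]_3).

Lemma bracketDr u v1 v2 : bracket alpha u (v1 + v2) = bracket alpha u v1 + bracket alpha u v2.
Proof. by apply: rv3P; rewrite !(mxE, rv3E) /=; ring. Qed.

Lemma bracketZr u x v : bracket alpha u (x *: v) = x *: bracket alpha u v.
Proof. by apply: rv3P; rewrite !(mxE, rv3E) /=; ring. Qed.

Lemma bracketC u v : bracket alpha u v = - bracket alpha v u.
Proof. by apply: rv3P; rewrite !(mxE, rv3E) /=; ring. Qed.

Lemma bracketuu u : bracket alpha u u = 0.
Proof. by apply: rv3P; rewrite !(mxE, rv3E) /=; ring. Qed.

Lemma lderiveZ u x f q : differentiable f q ->
  lderive alpha (x *: u) f q = x * lderive alpha u f q.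
Proof. by move=> df; rewrite /lderive lfieldZ !deriveE // linearZ. Qed.

Lemma lderiveB u v f q : differentiable f q ->
  lderive alpha (u - v) f q = lderive alpha u f q - lderive alpha v f q.
Proof.
move=> df; rewrite -scaleN1r /lderive lfieldD lfieldZ scaleN1r !deriveE //.
by rewrite linearB.
Qed.

Lemma lderive0 f q : lderive alpha 0 f q = 0.
Proof. by rewrite -(scale0r (0 : 'rV[R]_3)) /lderive lfieldZ scale0r derive0. Qed.

End Bracket.

Section Integrability.
Context {R : realType} (alpha : R) (g : 'rV[R]_3 -> 'M[R]_3).
Hypotheses (g_metric : riemannian_metric g setT) (g_inv : left_invariant alpha g).
Variables (f1 f2 f3 : 'rV[R]_3) (p k c : R).
Hypotheses (p_gt0 : 0 < p) (c_gt0 : 0 < c).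
Hypothesis f_span : forall a : 'rV[R]_3, exists x y z, a = x *: f1 + y *: f2 + z *: f3.
Hypotheses (f11 : inner g 0 f1 f1 = 1) (f22 : inner g 0 f2 f2 = 1)
  (f33 : inner g 0 f3 f3 = 1) (f12 : inner g 0 f1 f2 = 0)
  (f13 : inner g 0 f1 f3 = 0) (f23 : inner g 0 f2 f3 = 0).
Hypotheses (b12 : bracket alpha f1 f2 = p *: f2)
  (b13 : bracket alpha f1 f3 = (2 * k) *: f2 - c *: f3)
  (b23 : bracket alpha f2 f3 = 0).
Variables (U : set 'rV[R]_3) (T : 'rV[R]_3 -> 'rV[R]_3).
Hypotheses (oU : open U) (sT : smooth_mx U T).
Hypothesis T1 : forall q, U q -> inner g q (T q) (T q) = 1.
Hypothesis shear : forall q, U q -> exists rho : R, forall u v,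
  lie_metric g T q u v =
  2 * rho * (inner g q u v - inner g q u (T q) * inner g q v (T q)).

Local Notation lf := (lfield alpha).
Local Notation ld := (lderive alpha).
Let tau v q := inner g q (T q) (lf v q).
Let t1 := tau f1.
Let t2 := tau f2.
Let t3 := tau f3.

Let gs q : (g q)^T = g q. Proof. by case: g_metric => _ + _; apply. Qed.
Let g0C := innerC (gs 0).

Let smooth_tau v : smooth_fun U (tau v).
Proof.
apply: smooth_inner => //; last exact: smooth_lfield.
by apply: (smooth_mx_sub (W := setT)) => //; case: g_metric.
Qed.

Let T_frame q : U q -> T q = lf (t1 q *: f1 + t2 q *: f2 + t3 q *: f3) q.
Proof.
move=> Uq; have [a Ta] := lfield_surj alpha (T q) q.
have tauE v : tau v q = inner g 0 a v by rewrite /tau Ta inner_lfield.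
have [x [y [z aE]]] := f_span a.
rewrite /t1 /t2 /t3 !tauE Ta; congr (lf _ q).
rewrite {2 3 4}aE !innerDl !innerZl f11 f22 f33 f12 f13 f23.
by rewrite (g0C f2 f1) (g0C f3 f1) (g0C f3 f2) f12 f13 f23 !mulr0 !mulr1 !addr0 !add0r -aE.
Qed.

Let unit_t q : U q -> t1 q ^+ 2 = 1 - t2 q ^+ 2 - t3 q ^+ 2.
Proof.
move=> Uq; rewrite -(T1 Uq) [in RHS]T_frame // inner_lfield //.
rewrite !innerDl !(innerDr (gs 0)) !innerZl !(innerZr (gs 0)) f11 f22 f33 f12 f13 f23.
rewrite (g0C f2 f1) (g0C f3 f1) (g0C f3 f2) f12 f13 f23; ring.
Qed.

Let d u v q := ld u (tau v) q.

Let smooth_d u v : smooth_fun U (d u v).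
Proof. exact: smooth_lderive. Qed.

Let diff_t v q : U q -> differentiable (tau v) q.
Proof. exact: smooth_differentiable. Qed.

Let unit_d v q : U q -> t1 q * d v f1 q + t2 q * d v f2 q + t3 q * d v f3 q = 0.
Proof.
move=> Uq.
have idt u : is_derive q (lf v q) (tau u) (d v u q).
  by apply: DeriveDef => //; apply: diff_derivable; apply: diff_t.
have := eq_on_derive (f := fun y => t1 y ^+ 2) (lf v q) oU Uq unit_t.
rewrite (derive_sqr (idt f1)).
rewrite (derive_1Bsqr2 (idt f2) (idt f3)) -/t1 -/t2 -/t3.
move: (t1 q) (t2 q) (t3 q) (d v f1 q) (d v f2 q) (d v f3 q) => y1 y2 y3 x1 x2 x3 e.
by apply: (eq_of_half e); field.
Qed.

Let sym_d q : U q -> exists rho : R, forall u v,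
  d u v q + d v u q + inner g 0 (bracket alpha u (t1 q *: f1 + t2 q *: f2 + t3 q *: f3)) v
  + inner g 0 (bracket alpha v (t1 q *: f1 + t2 q *: f2 + t3 q *: f3)) u
  = 2 * rho * (inner g 0 u v - tau u q * tau v q).
Proof.
move=> Uq; have [rho rhoE] := shear Uq; exists rho => u v.
rewrite /d -(lie_metric_lfield g_metric g_inv u v (smooth_diff_mx sT Uq) (T_frame Uq)).
by rewrite rhoE (innerC (gs q) _ (T q)) (innerC (gs q) (lf v q)) inner_lfield.
Qed.

Let rho q := expansion p c (t1 q) (d f1 f1 q) (d f2 f2 q) (d f3 f3 q).
Let w q := twist p k c (t1 q) (t2 q) (t3 q) (d f1 f2 q) (d f1 f3 q) (d f2 f1 q) (d f2 f3 q)
  (d f3 f1 q) (d f3 f2 q).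

Let smooth_rho : smooth_fun U rho.
Proof.
apply: (smoothM oU); first exact: smooth_cst.
apply: (smoothB oU); last by apply: (smoothM oU); [exact: smooth_cst|exact: smooth_tau].
by do 2!(apply: (smoothD oU); last exact: smooth_d); exact: smooth_d.
Qed.

Let smooth_w : smooth_fun U w.
Proof.
apply: (smoothM oU); first exact: smooth_cst.
repeat first [exact: smooth_cst | exact: smooth_d | exact: smooth_tau
  | apply: (smoothD oU) | apply: (smoothN oU) | apply: (smoothM oU)].
Qed.

Let system q : U q ->
  [/\ [/\ d f1 f1 q = grad11 (t1 q) (rho q), d f1 f2 q = grad12 k (t1 q) (t2 q) (t3 q) (rho q) (w q)
        & d f1 f3 q = grad13 k (t1 q) (t2 q) (t3 q) (rho q) (w q)],
      [/\ d f2 f1 q = grad21 p k (t1 q) (t2 q) (t3 q) (rho q) (w q),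
          d f2 f2 q = grad22 p (t1 q) (t2 q) (rho q)
        & d f2 f3 q = grad23 k (t1 q) (t2 q) (t3 q) (rho q) (w q)]
    & [/\ d f3 f1 q = grad31 k c (t1 q) (t2 q) (t3 q) (rho q) (w q),
          d f3 f2 q = grad32 k (t1 q) (t2 q) (t3 q) (rho q) (w q)
        & d f3 f3 q = grad33 c (t1 q) (t3 q) (rho q)]].
Proof.
move=> Uq; have [r rE] := sym_d Uq.
have b1 : bracket alpha f1 (t1 q *: f1 + t2 q *: f2 + t3 q *: f3) =
   (t2 q * p + 2 * k * t3 q) *: f2 + (- c * t3 q) *: f3.
  rewrite !bracketDr !bracketZr bracketuu b12 b13 scaler0 add0r.
  by apply: rv3P; rewrite !mxE; ring.
have b2 : bracket alpha f2 (t1 q *: f1 + t2 q *: f2 + t3 q *: f3) = (- p * t1 q) *: f2.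
  rewrite !bracketDr !bracketZr bracketuu (bracketC _ f2 f1) b12 b23 !scaler0 !addr0.
  by apply: rv3P; rewrite !mxE; ring.
have b3 : bracket alpha f3 (t1 q *: f1 + t2 q *: f2 + t3 q *: f3) =
   (- 2 * k * t1 q) *: f2 + (c * t1 q) *: f3.
  rewrite !bracketDr !bracketZr bracketuu (bracketC _ f3 f1) (bracketC _ f3 f2) b13 b23.
  by apply: rv3P; rewrite !mxE; ring.
have S u v := rE u v; move: (S f1 f1) (S f2 f2) (S f3 f3) (S f1 f2) (S f1 f3) (S f2 f3).
rewrite b1 b2 b3 !innerDl !innerZl (g0C f2 f1) (g0C f3 f1) (g0C f3 f2) f11 f22 f33 f12 f13 f23.
rewrite -/t1 -/t2 -/t3 => s11 s22 s33 s12 s13 s23.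
have u1 := unit_d f1 Uq; have u2 := unit_d f2 Uq; have u3 := unit_d f3 Uq.
have tu := unit_t Uq; rewrite -/t1 -/t2 -/t3 in u1 u2 u3 tu.
have e11 : d f1 f1 q = r * (1 - t1 q ^+ 2) by apply: (eq_of_half s11); field.
have e22 : d f2 f2 q - p * t1 q = r * (1 - t2 q ^+ 2) by apply: (eq_of_half s22); field.
have e33 : d f3 f3 q + c * t1 q = r * (1 - t3 q ^+ 2) by apply: (eq_of_half s33); field.
(* The factor [r], given at the single point [q] only, is identified with the value of the smooth
   function [rho]. *)
have rhoE : rho q = r := expansionE tu e11 e22 e33.
have e12 : d f1 f2 q + d f2 f1 q + p * t2 q + 2 * k * t3 q = - 2 * r * t1 q * t2 q.
  by apply/eqP; rewrite -subr_eq0; apply/eqP; move/eqP: s12; rewrite -subr_eq0 => /eqP <-; ring.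
have e13 : d f1 f3 q + d f3 f1 q - c * t3 q = - 2 * r * t1 q * t3 q.
  by apply/eqP; rewrite -subr_eq0; apply/eqP; move/eqP: s13; rewrite -subr_eq0 => /eqP <-; ring.
have e23 : d f2 f3 q + d f3 f2 q - 2 * k * t1 q = - 2 * r * t2 q * t3 q.
  by apply/eqP; rewrite -subr_eq0; apply/eqP; move/eqP: s23; rewrite -subr_eq0 => /eqP <-; ring.
rewrite rhoE; exact: (first_order_system tu u1 u2 u3 e11 e22 e33 e12 e13 e23).
Qed.

Let is_derive_t u v q : U q -> is_derive q (lf v q) (tau u) (d v u q).
Proof. by move=> Uq; apply: DeriveDef => //; apply: diff_derivable; apply: diff_t. Qed.

Let is_derive_smooth h v q : smooth_fun U h -> U q -> is_derive q (lf v q) h (ld v h q).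
Proof.
move=> sh Uq; apply: DeriveDef => //; apply: diff_derivable.
exact: smooth_differentiable sh Uq.
Qed.

Let comm u v x q : U q ->
  ld u (d v x) q - ld v (d u x) q = ld (bracket alpha u v) (tau x) q.
Proof. by move=> Uq; apply: (lderive_comm alpha u v oU (smooth_tau x) Uq). Qed.

Let riccati q : U q -> exists l : R,
  [/\ (p ^+ 2 + p * c) * t1 q ^+ 2 = l * (1 - t2 q ^+ 2),
      (c ^+ 2 + p * c + 4 * k ^+ 2) * t1 q ^+ 2 = l * (1 - t3 q ^+ 2),
      - 2 * p * k * t1 q ^+ 2 = l * (t2 q * t3 q)
    & (c ^+ 2 + p * c + 4 * k ^+ 2) * t3 q ^+ 2 - 2 * (- 2 * p * k) * (t2 q * t3 q)
      + (p ^+ 2 + p * c) * t2 q ^+ 2 = l * (1 - t1 q ^+ 2)].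
Proof.
move=> Uq; have [[s11 s12 s13] [s21 s22 s23] [s31 s32 s33]] := system Uq.
pose r v := ld v rho q; pose o v := ld v w q.
have h1 v := is_derive_t f1 v Uq; have h2 v := is_derive_t f2 v Uq.
have h3 v := is_derive_t f3 v Uq.
have hr v : is_derive q (lf v q) rho (r v) := is_derive_smooth v smooth_rho Uq.
have hw v : is_derive q (lf v q) w (o v) := is_derive_smooth v smooth_w Uq.
(* [system] holds throughout the open set [U], so both sides of each of its nine equations have
   equal derivatives at [q]. *)
have L11 v : ld v (d f1 f1) q =
    dgrad11 (t1 q) (rho q) (r v) (o v) (d v f1 q) (d v f2 q) (d v f3 q).
  transitivity ('D_(lf v q) (fun y => grad11 (t1 y) (rho y)) q);
    last by apply: derive_grad11; first [exact: h1|exact: h2|exact: h3|exact: hr|exact: hw].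
  by apply: (eq_on_derive _ oU Uq) => y Uy; have [[e _ _] _ _] := system Uy.
have L12 v : ld v (d f1 f2) q =
    dgrad12 k (t1 q) (t2 q) (t3 q) (rho q) (w q) (r v) (o v) (d v f1 q) (d v f2 q) (d v f3 q).
  transitivity ('D_(lf v q) (fun y => grad12 k (t1 y) (t2 y) (t3 y) (rho y) (w y)) q);
    last by apply: derive_grad12; first [exact: h1|exact: h2|exact: h3|exact: hr|exact: hw].
  by apply: (eq_on_derive _ oU Uq) => y Uy; have [[_ e _] _ _] := system Uy.
have L13 v : ld v (d f1 f3) q =
    dgrad13 k (t1 q) (t2 q) (t3 q) (rho q) (w q) (r v) (o v) (d v f1 q) (d v f2 q) (d v f3 q).
  transitivity ('D_(lf v q) (fun y => grad13 k (t1 y) (t2 y) (t3 y) (rho y) (w y)) q);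
    last by apply: derive_grad13; first [exact: h1|exact: h2|exact: h3|exact: hr|exact: hw].
  by apply: (eq_on_derive _ oU Uq) => y Uy; have [[_ _ e] _ _] := system Uy.
have L21 v : ld v (d f2 f1) q =
    dgrad21 p k (t1 q) (t2 q) (t3 q) (rho q) (w q) (r v) (o v) (d v f1 q) (d v f2 q) (d v f3 q).
  transitivity ('D_(lf v q) (fun y => grad21 p k (t1 y) (t2 y) (t3 y) (rho y) (w y)) q);
    last by apply: derive_grad21; first [exact: h1|exact: h2|exact: h3|exact: hr|exact: hw].
  by apply: (eq_on_derive _ oU Uq) => y Uy; have [_ [e _ _] _] := system Uy.
have L22 v : ld v (d f2 f2) q =
    dgrad22 p (t2 q) (rho q) (r v) (o v) (d v f1 q) (d v f2 q) (d v f3 q).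
  transitivity ('D_(lf v q) (fun y => grad22 p (t1 y) (t2 y) (rho y)) q);
    last by apply: derive_grad22; first [exact: h1|exact: h2|exact: h3|exact: hr|exact: hw].
  by apply: (eq_on_derive _ oU Uq) => y Uy; have [_ [_ e _] _] := system Uy.
have L23 v : ld v (d f2 f3) q =
    dgrad23 k (t1 q) (t2 q) (t3 q) (rho q) (w q) (r v) (o v) (d v f1 q) (d v f2 q) (d v f3 q).
  transitivity ('D_(lf v q) (fun y => grad23 k (t1 y) (t2 y) (t3 y) (rho y) (w y)) q);
    last by apply: derive_grad23; first [exact: h1|exact: h2|exact: h3|exact: hr|exact: hw].
  by apply: (eq_on_derive _ oU Uq) => y Uy; have [_ [_ _ e] _] := system Uy.
have L31 v : ld v (d f3 f1) q =
    dgrad31 k c (t1 q) (t2 q) (t3 q) (rho q) (w q) (r v) (o v) (d v f1 q) (d v f2 q) (d v f3 q).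
  transitivity ('D_(lf v q) (fun y => grad31 k c (t1 y) (t2 y) (t3 y) (rho y) (w y)) q);
    last by apply: derive_grad31; first [exact: h1|exact: h2|exact: h3|exact: hr|exact: hw].
  by apply: (eq_on_derive _ oU Uq) => y Uy; have [_ _ [e _ _]] := system Uy.
have L32 v : ld v (d f3 f2) q =
    dgrad32 k (t1 q) (t2 q) (t3 q) (rho q) (w q) (r v) (o v) (d v f1 q) (d v f2 q) (d v f3 q).
  transitivity ('D_(lf v q) (fun y => grad32 k (t1 y) (t2 y) (t3 y) (rho y) (w y)) q);
    last by apply: derive_grad32; first [exact: h1|exact: h2|exact: h3|exact: hr|exact: hw].
  by apply: (eq_on_derive _ oU Uq) => y Uy; have [_ _ [_ e _]] := system Uy.
have L33 v : ld v (d f3 f3) q =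
    dgrad33 c (t3 q) (rho q) (r v) (o v) (d v f1 q) (d v f2 q) (d v f3 q).
  transitivity ('D_(lf v q) (fun y => grad33 c (t1 y) (t3 y) (rho y)) q);
    last by apply: derive_grad33; first [exact: h1|exact: h2|exact: h3|exact: hr|exact: hw].
  by apply: (eq_on_derive _ oU Uq) => y Uy; have [_ _ [_ _ e]] := system Uy.
have c12 x : ld f1 (d f2 x) q - ld f2 (d f1 x) q = p * d f2 x q.
  by rewrite comm // b12 lderiveZ //; apply: diff_t.
have c13 x : ld f1 (d f3 x) q - ld f3 (d f1 x) q = 2 * k * d f2 x q - c * d f3 x q.
  have dx := diff_t x Uq.
  by rewrite comm // b13 lderiveB // !lderiveZ.
have c23 x : ld f2 (d f3 x) q - ld f3 (d f2 x) q = 0.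
  by rewrite comm // b23 lderive0.
exact: (riccati_relations (unit_t Uq) s11 s12 s13 s21 s22 s23 s31 s32 s33
  (L21 f1) (L11 f2) (L22 f1) (L12 f2) (L23 f1) (L13 f2) (L31 f1) (L11 f3) (L32 f1) (L12 f3) (L33 f1) (L13 f3) (L32 f2) (L22 f3) (L33 f2) (L23 f3)
  (c12 f1) (c12 f2) (c12 f3) (c13 f1) (c13 f2) (c13 f3) (c23 f2) (c23 f3)).
Qed.

Let M22 := c ^+ 2 + p * c + 4 * k ^+ 2.
Let M33 := p ^+ 2 + p * c.
Let M23 := - 2 * p * k.

Let M22_gt0 : 0 < M22.
Proof.
apply: ltr_pwDl; first by rewrite addr_gt0 ?mulr_gt0 ?exprn_gt0.
by rewrite mulr_ge0 ?sqr_ge0.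
Qed.

Let M_det : 0 < M22 * M33 - M23 ^+ 2.
Proof.
have -> : M22 * M33 - M23 ^+ 2 = p * c * ((p + c) ^+ 2 + 4 * k ^+ 2).
  by rewrite /M22 /M33 /M23; ring.
rewrite mulr_gt0 ?mulr_gt0 //; apply: ltr_pwDl; first by rewrite exprn_gt0 // addr_gt0.
by rewrite mulr_ge0 ?sqr_ge0.
Qed.

Let t_neq0 q : U q -> t1 q != 0.
Proof.
move=> Uq; have [l [r22 r33 r23 r11]] := riccati Uq.
exact: (ricci_neq0 M22_gt0 M_det (unit_t Uq) r22 r33 r11).
Qed.

Let relation1 q : U q ->
  (M22 * M33 - M23 ^+ 2) * (1 + t1 q ^+ 2) ^+ 2 = (M22 + M33) ^+ 2 * t1 q ^+ 2.
Proof.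
move=> Uq; have [l [r22 r33 r23 r11]] := riccati Uq.
exact: (ricci_t1 M22_gt0 M_det (unit_t Uq) r22 r33 r23 r11).
Qed.

Let relation2 q : U q -> (M22 + M33) * (1 - t2 q ^+ 2) = M33 * (1 + t1 q ^+ 2).
Proof.
move=> Uq; have [l [r22 r33 r23 r11]] := riccati Uq.
exact: (ricci_t2 M22_gt0 M_det (unit_t Uq) r22 r33 r11).
Qed.

Let relation3 q : U q -> (M22 + M33) * (1 - t3 q ^+ 2) = M22 * (1 + t1 q ^+ 2).
Proof.
move=> Uq; have [l [r22 r33 r23 r11]] := riccati Uq.
exact: (ricci_t3 M22_gt0 M_det (unit_t Uq) r22 r33 r11).
Qed.

Let relation23 q : U q -> (M22 + M33) * (t2 q * t3 q) = M23 * (1 + t1 q ^+ 2).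
Proof.
move=> Uq; have [l [r22 r33 r23 r11]] := riccati Uq.
exact: (ricci_t23 M22_gt0 M_det (unit_t Uq) r22 r33 r23 r11).
Qed.

Let tau_gt0 : 0 < M22 + M33.
Proof. by rewrite addr_gt0 // addr_gt0 ?mulr_gt0 ?exprn_gt0. Qed.

Let constant q v : U q -> d v f2 q = 0 /\ d v f3 q = 0.
Proof.
move=> Uq; have [t23|] := boolP ((t2 q == 0) && (t3 q == 0)).
  (* T = e1 up to sign at the single point [q] already forces M to be scalar. This is a condition on
     constants, so [rigidity_degenerate] applies at every point of [U] and t2, t3 vanish
     identically. *)
  have [t20 t30] : t2 q = 0 /\ t3 q = 0 by case/andP: t23 => /eqP-> /eqP->.
  have t11 : t1 q ^+ 2 = 1 by rewrite unit_t // t20 t30 expr0n /= !subr0.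
  have M2233 : M22 = M33.
    by have := relation2 Uq; rewrite t11 t20 expr0n /= subr0; lra.
  have M230 : M23 = 0.
    by have := relation23 Uq; rewrite t11 t20 mul0r mulr0; lra.
  have t0 y : U y -> t2 y = 0 /\ t3 y = 0.
    move=> Uy; have e2 := relation2 Uy; have e3 := relation23 Uy.
    rewrite (unit_t Uy) in e2 e3.
    exact: (rigidity_degenerate tau_gt0 M2233 M230 e2 e3).
  split.
    rewrite /d /lderive (eq_on_derive (h := fun=> 0) _ oU Uq) ?derive_cst //.
    by move=> y /t0 [].
  rewrite /d /lderive (eq_on_derive (h := fun=> 0) _ oU Uq) ?derive_cst //.
  by move=> y /t0 [].
rewrite negb_and => /orP t23.
have h1 := is_derive_t f1 v Uq; have h2 := is_derive_t f2 v Uq.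
have h3 := is_derive_t f3 v Uq.
(* The relations involve t1 only through t1^2, whose derivative takes the place of x1 in
   [rigidity]. *)
have hk := is_derive_sqr h1.
have E1 := eq_on_derive (lf v q) oU Uq relation1.
have E2 := eq_on_derive (lf v q) oU Uq relation2.
have E3 := eq_on_derive (lf v q) oU Uq relation3.
have E23 := eq_on_derive (lf v q) oU Uq relation23.
rewrite (derive_1Dsqr _ hk) (derive_scale _ hk) in E1.
rewrite (derive_1Bsqr _ h2) (derive_1D _ hk) in E2.
rewrite (derive_1Bsqr _ h3) (derive_1D _ hk) in E3.
rewrite (derive_mul _ h2 h3) (derive_1D _ hk) in E23.
exact: (rigidity M22_gt0 M_det (unit_t Uq) (relation1 Uq) E1 E2 E3 E23 t23).
Qed.

Lemma no_shear_free_geodesic_field q : ~ U q.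
Proof.
move=> Uq; have [_ [_ d22 _] [_ _ d33]] := system Uq.
have [d220 _] := constant f2 Uq; have [_ d330] := constant f3 Uq.
move: d22 d33; rewrite d220 d330 /grad22 /grad33.
have := t_neq0 Uq; have := unit_t Uq.
move: (t1 q) (t2 q) (t3 q) (rho q) => y1 y2 y3 r tu y10 e2 e3.
have : p * c * y1 ^+ 2 <= 0.
  have -> : p * c * y1 ^+ 2 = (p * y1) * (c * y1) by ring.
  have -> : p * y1 = - (r * (1 - y2 ^+ 2)) by lra.
  have -> : c * y1 = r * (1 - y3 ^+ 2) by lra.
  have -> : 1 - y2 ^+ 2 = y1 ^+ 2 + y3 ^+ 2 by lra.
  have -> : 1 - y3 ^+ 2 = y1 ^+ 2 + y2 ^+ 2 by lra.
  rewrite mulNr oppr_le0 mulrACA mulr_ge0 -?expr2 ?sqr_ge0 //.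
  by rewrite mulr_ge0 ?addr_ge0 ?sqr_ge0.
have y1s : 0 < y1 ^+ 2 by rewrite lt0r sqrf_eq0 y10 sqr_ge0.
by rewrite leNgt (mulr_gt0 (mulr_gt0 p_gt0 c_gt0) y1s).
Qed.

End Integrability.

(** * Local unit sections and the conclusion *)

Lemma exists_unit_section (R : realType) n (g : 'rV[R]_n -> 'M[R]_n) (W : set 'rV[R]_n)
    (D : 'rV[R]_n -> 'M[R]_n) (p : 'rV[R]_n) :
  riemannian_metric g setT -> Defs.distribution 1 W D -> W p ->
  exists (U : set 'rV[R]_n) (T : 'rV[R]_n -> 'rV[R]_n),
    [/\ open U, U p, U `<=` W, smooth_mx U T &
      forall q, U q -> inner g q (T q) (T q) = 1 /\ (D q == T q)%MS].
Proof.
move=> [sg gs gp] /[apply] -[U [F [oU Up UW sF FD]]].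
have F0 q : U q -> 0 < inner g q (F q) (F q).
  move=> /FD [Ffree _]; apply: gp => //; apply: contraTneq Ffree => ->.
  by rewrite /row_free mxrank0.
exists U, (fun q => (Num.sqrt (inner g q (F q) (F q)))^-1 *: F q); split=> //.
  apply: smooth_mxZ => //; apply: smooth_rsqrt => //; apply: smooth_inner => //.
  exact: smooth_mx_sub sg.
move=> q Uq; have s0 : Num.sqrt (inner g q (F q) (F q)) != 0.
  by rewrite gt_eqF // sqrtr_gt0 F0.
split.
  rewrite innerZl (innerZr (gs q I)) mulrA -expr2 exprVn sqr_sqrtr ?ltW ?F0 //.
  by rewrite mulVf // gt_eqF ?F0.
have [_ /andP[DF FD']] := FD q Uq.
by rewrite !eqmx_scale ?invr_eq0 // DF FD'.
Qed.

Theorem mainTheorem6 (R : realType) (alpha : R) (alpha_gt0 : 0 < alpha)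
    (g : 'rV[R]_3 -> 'M[R]_3)
    (g_metric : riemannian_metric g setT)
    (g_inv : left_invariant alpha g)
    (W : set 'rV[R]_3) (W_open : open W) (W_neq0 : W !=set0)
    (W_conn : connected W) :
  ~ exists D : 'rV[R]_3 -> 'M[R]_3, conformal_foliation_by_geodesics g W D.
Proof.
move=> [D [dist _ conf geod]]; have [q0 Wq0] := W_neq0.
have [U [T [oU Uq0 UW sT TD]]] := exists_unit_section g_metric dist Wq0.
have [gs gp] : (g 0)^T = g 0 /\ forall u, u != 0 -> 0 < inner g 0 u u.
  by case: g_metric => _ gs gp; split=> [|u]; [apply: gs | apply: gp].
have gU : riemannian_metric g U.
  case: g_metric => sg gs' gp'; split=> [|q _|q u _]; [|exact: gs'|exact: gp'].
  exact: smooth_mx_sub sg.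
have [c [i [j [r [s [m [c0 r0 m0 [[f11 f22 f33] [f12 f13 f23]]]]]]]]] :=
  exists_orthonormal_frame gs gp.
have [c_neq r_neq m_neq] : [/\ c != 0, r != 0 & m != 0] by rewrite !gt_eqF.
(* The action of f1 on the ideal is c diag(alpha, -1). Thus [f1,f2] = alpha c f2, and [f1,f3] = (0,
   alpha c s, - c m) is - c f3 plus (alpha + 1) c s in the y-direction, which is (alpha + 1) c s / r
   times f2; this coefficient is 2k. *)
apply: (@no_shear_free_geodesic_field R alpha g g_metric g_inv
  (rv3 c i j) (rv3 0 r 0) (rv3 0 s m) (alpha * c) (c * s * (alpha + 1) / (2 * r)) c
  _ _ _ f11 f22 f33 f12 f13 f23 _ _ _ U T oU sT _ _ q0) => //.
- by rewrite mulr_gt0.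
- move=> a; exists (a 0 0 / c).
  exists ((a 0 1 - a 0 0 / c * i - (a 0 2 - a 0 0 / c * j) / m * s) / r).
  exists ((a 0 2 - a 0 0 / c * j) / m).
  by apply: rv3P; rewrite !(mxE, rv3E) /=; field; rewrite ?c_neq ?r_neq ?m_neq.
- by apply: rv3P; rewrite !(mxE, rv3E) /=; ring.
- by apply: rv3P; rewrite !(mxE, rv3E) /=; field; rewrite ?r_neq.
- by apply: rv3P; rewrite !(mxE, rv3E) /=; ring.
- by move=> q /TD [].
- move=> q Uq; apply: (lie_metric_shear_free oU UW gU sT _ _ Uq conf geod) => y /TD [] //.
Qed.
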